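(* Let $p$ be a prime, $S$ a finite $p$-group, $\mathcal{F}$ a saturated fusion system on $S$, and $\Lambda_{\mathcal{F}}$ the minimal $\mathcal{F}$-characteristic biset. Call two $\mathcal{F}$-isomorphisms $\varphi_1\colon P_1\to Q_1$ and $\varphi_2\colon P_2\to Q_2$ equivalent if there exist $a,b\in S$ such that $\varphi_2=c_b\circ\varphi_1\circ c_a$. Then the $\mathcal{F}$-centric part of $\Lambda_{\mathcal{F}}$ has exactly one $(S,S)$-orbit for each equivalence class of nonextendable isomorphisms of $\mathcal{F}$ between $\mathcal{F}$-centric subgroups of $S$, and the orbit corresponding to the class of $\varphi\colon P\to Q$ is isomorphic to $[P,\varphi]=S\times_{(P,\varphi)}S$.
   Context: Fusion systems and saturation are in the usual sense (Puig; Broto-Levi-Oliver). $\mathcal{F}(P,Q)$ denotes the set of $\mathcal{F}$-morphisms $P\to Q$ for $P,Q\le S$. $P\le S$ is $\mathcal{F}$-centric if $C_S(Q)\le Q$ for every $Q$ that is $\mathcal{F}$-isomorphic to $P$. For $g\in S$, $c_g$ is conjugation $x\mapsto gxg^{-1}$, restricted to the appropriate subgroups (so $c_a\colon a^{-1}P_1a\to P_1$ and $c_b\colon Q_1\to bQ_1b^{-1}$). An $\mathcal{F}$-isomorphism $\varphi\colon P\to Q$ is nonextendable if there is no $\widetilde P$ with $P\lneq\widetilde P\le S$ and $\widetilde\varphi\in\mathcal{F}(\widetilde P,S)$ with $\widetilde\varphi|_P=\varphi$. All bisets are finite. An $(S,S)$-biset is a finite set $\Omega$ with a free left $S$-action and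 a free right $S$-action that commute; equivalently a left $(S\times S)$-set via $(b,a)\cdot\omega=b\cdot\omega\cdot a^{-1}$ on which $S\times 1$ and $1\times S$ act freely. For $P\le S$ and an injective homomorphism $\varphi\colon P\to S$, write $(P,\varphi)=\{(\varphi(a),a)\mid a\in P\}\le S\times S$, and $[P,\varphi]=S\times_{(P,\varphi)}S\cong(S\times S)/(P,\varphi)$. Every point-stabilizer in an $(S,S)$-biset has the form $(P,\varphi)$. $\Omega^{(P,\varphi)}$ denotes the set of points fixed by $(P,\varphi)$. $\Omega$ is $\mathcal{F}$-generated if every point-stabilizer is of the form $(P,\varphi)$ with $\varphi\in\mathcal{F}(P,S)$. $\Omega$ is $\mathcal{F}$-stable if for every $P\le S$, injective homomorphism $\varphi\colon P\to S$, and $\mathcal{F}$-isomorphisms $\eta_1\colon Q\to P$ and $\eta_2\colon\varphi(P)\to R$, one has $|\Omega^{(P,\varphi)}|=|\Omega^{(Q,\eta_2\varphi\eta_1)}|$. $\Omega$ is $\mathcal{F}$-characteristic if it is $\mathcal{F}$-generated, $\mathcal{F}$-stable, and $|\Omega|/|S|\not\equiv 0\pmod p$. Every saturated $\mathcal{F}$ has a unique (up to isomorphism) minimal $\mathcal{F}$-characteristic biset $\Lambda_{\mathcal{F}}$, meaning one that is, up to isomorphism, contained in every $\mathcal{F}$-characteristic biset. The $\mathcal{F}$-centric part of an $\mathcal{F}$-generated biset is obtained by removing all orbits isomorphic to $[Q,\psi]$ with $Q$ not $\mathcal{F}$-centric. *)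

(* Defs.v *)
From HB Require Import structures.
From mathcomp Require Import all_boot all_fingroup all_solvable.

Set Implicit Arguments.
Unset Strict Implicit.
Unset Printing Implicit Defensive.

Import GroupScope.

(* The ambient finite group S is the whole finGroupType [gT]; its subgroups are
   the terms of [{group gT}].  A map with source P is encoded by the finfun on
   [gT] that takes the value 1 outside P, so that equality of maps with the same
   source is Leibniz equality. *)

Section Maps.
Variable gT : finGroupType.
Implicit Types (P Q : {group gT}) (f : gT -> gT).

Definition injhom P Q : {set {ffun gT -> gT}} :=
  [set phi in pffun_on 1 (mem P) (mem Q) | morphic P phi && dinjectiveb phi P].

Definition restr P f : {ffun gT -> gT} := [ffun x => if x \in P then f x else 1].

(* Left conjugation, whereas mathcomp's [x ^ g] is [g^-1 * x * g]. *)
Definition cl (g x : gT) : gT := g * x * g^-1.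

(* Pairs (P, phi) with P a subgroup of S and phi : P -> S an injective
   homomorphism. *)
Record mono : Type := Mono {
  mpair : {group gT} * {ffun gT -> gT};
  _ : mpair.2 \in injhom mpair.1 [set: gT]%G
}.

HB.instance Definition _ := [isSub for mpair].
HB.instance Definition _ := [Countable of mono by <:].
HB.instance Definition _ := [Finite of mono by <:].

Definition dom (u : mono) : {group gT} := (mpair u).1.
Definition mfun (u : mono) : {ffun gT -> gT} := (mpair u).2.

Lemma mfunM (u : mono) : {in dom u &, {morph mfun u : x y / x * y}}.
Proof. by have := valP u; rewrite inE => /and3P[_ /morphicP]. Qed.

Lemma mfun_inj (u : mono) : {in dom u &, injective (mfun u)}.
Proof. by have := valP u; rewrite inE => /and3P[_ _ /dinjectiveP]. Qed.

Lemma mfun1 (u : mono) : mfun u 1 = 1.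
Proof. by apply: (mulgI (mfun u 1)); rewrite -mfunM ?group1 // !mulg1. Qed.

Lemma group_set_img (u : mono) : group_set (mfun u @: dom u).
Proof.
apply/group_setP; split; first by rewrite -(mfun1 u) imset_f ?group1.
move=> _ _ /imsetP[x Px ->] /imsetP[y Py ->].
by rewrite -mfunM // imset_f ?groupM.
Qed.

Definition img (u : mono) : {group gT} := Group (group_set_img u).

(* The subgroup {(phi(a), a) | a in P} of S x S. *)
Definition twdiag P f : {set gT * gT} := [set (f a, a) | a in P].

Lemma group_set_twdiag (u : mono) : group_set (twdiag (dom u) (mfun u)).
Proof.
apply/group_setP; split.
  by apply/imsetP; exists 1; rewrite ?group1 // mfun1.
move=> _ _ /imsetP[x Px ->] /imsetP[y Py ->].
by apply/imsetP; exists (x * y); rewrite ?groupM // mfunM.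
Qed.

Canonical twdiag_group u := Group (group_set_twdiag u).

End Maps.

Section FusionSystems.
Variable gT : finGroupType.
Implicit Types (P Q R : {group gT}) (phi psi : {ffun gT -> gT}).

Definition isob (hom : {group gT} -> {group gT} -> {set {ffun gT -> gT}})
    P Q phi : bool :=
  (phi \in hom P Q) &&
  [exists psi in hom Q P,
     [forall x in P, psi (phi x) == x] && [forall y in Q, phi (psi y) == y]].

Record fusion_system := FusionSystem {
  fhom :> {group gT} -> {group gT} -> {set {ffun gT -> gT}};
  fhom_injhom : forall P Q, fhom P Q \subset injhom P Q;
  fhom_conj : forall P Q g,
    cl g @: P \subset Q -> restr P (cl g) \in fhom P Q;
  fhom_comp : forall P Q R phi psi,
    phi \in fhom P Q -> psi \in fhom Q R -> restr P (psi \o phi) \in fhom P R;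
  fhom_factor : forall P Q phi, phi \in fhom P Q ->
    exists2 R : {group gT}, R \subset Q & isob fhom P R phi
}.

Variable F : fusion_system.

Definition fiso P Q phi : bool := isob F P Q phi.

Definition fconj P Q : bool := [exists phi, fiso P Q phi].

Definition centric P : bool := [forall Q, fconj P Q ==> ('C(Q) \subset Q)].

Definition fully_centralized P : bool :=
  [forall Q, fconj P Q ==> (#|'C(Q)| <= #|'C(P)|)].

Definition fully_normalized P : bool :=
  [forall Q, fconj P Q ==> (#|'N(Q)| <= #|'N(P)|)].

(* mathcomp's [Aut P] consists of permutations of the whole type [gT] which fix
   every point outside P. *)
Definition AutF P : {set {perm gT}} := [set s in Aut P | restr P s \in F P P].

Definition AutS P : {set {perm gT}} := conj_aut P @* 'N(P).

(* N_phi, consisting of the g in N_S(P) with phi c_g phi^-1 in Aut_S(phi(P)). *)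
Definition extender (u : mono gT) : {set gT} :=
  [set g in 'N(dom u) | [exists h in 'N(img u),
     [forall x in dom u, mfun u (cl g x) == cl h (mfun u x)]]].

Lemma group_set_extender (u : mono gT) : group_set (extender u).
Proof.
have clJ g x : cl g x = x ^ g^-1 by rewrite /cl conjgE invgK mulgA.
apply/group_setP; split.
  apply/setIdP; split; first exact: group1.
  apply/exists_inP; exists 1; first exact: group1.
  by apply/forall_inP => x _; rewrite !clJ invg1 !conjg1.
move=> g1 g2 /setIdP[N1 /exists_inP[h1 M1 /forall_inP E1]].
move=> /setIdP[N2 /exists_inP[h2 M2 /forall_inP E2]].
apply/setIdP; split; first exact: groupM.
apply/exists_inP; exists (h1 * h2); first exact: groupM.
have clM g h x : cl (g * h) x = cl g (cl h x) by rewrite /cl invMg !mulgA.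
apply/forall_inP => x Px; rewrite !clM -(eqP (E2 _ Px)) E1 //.
by rewrite clJ memJ_norm ?groupV.
Qed.

Canonical extender_group u := Group (group_set_extender u).

(* The saturation axioms (I) and (II) of Broto, Levi and Oliver. *)
Definition saturated (p : nat) : Prop :=
  (forall P, fully_normalized P ->
     fully_centralized P /\ p.-Sylow(AutF P) (AutS P)) /\
  (forall u : mono gT, mfun u \in F (dom u) [set: gT]%G ->
     fully_centralized (img u) ->
     exists2 psi, psi \in F (extender u)%G [set: gT]%G
                & restr (dom u) psi = mfun u).

(* The F-isomorphisms phi : P -> Q; here P = [dom u] and Q = [img u]. *)
Definition misof (u : mono gT) : bool := fiso (dom u) (img u) (mfun u).

Definition nonextendable (u : mono gT) : bool :=
  ~~ [exists Pt : {group gT}, (dom u \proper Pt) &&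
        [exists psi in F Pt [set: gT]%G, restr (dom u) psi == mfun u]].

Definition nonext_centric_isos : {set mono gT} :=
  [set u | [&& misof u, centric (dom u), centric (img u) & nonextendable u]].

(* Here [dom u :^ a] is a^-1 P_1 a; the targets then satisfy
   Q_2 = b Q_1 b^-1, both being images. *)
Definition iso_equiv : rel (mono gT) := fun u v =>
  [exists a, [exists b,
    (dom v == (dom u :^ a)%G) &&
    (mfun v == restr (dom v) (cl b \o mfun u \o cl a))]].

Definition iso_classes : {set {set mono gT}} :=
  equivalence_partition iso_equiv nonext_centric_isos.

End FusionSystems.

Section Bisets.
Variable gT : finGroupType.

Record biset := Biset {
  bcar :> finType;
  lact : gT -> bcar -> bcar;
  ract : bcar -> gT -> bcar;
  lact1 : forall w, lact 1 w = w;
  lactM : forall b c w, lact (b * c) w = lact b (lact c w);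
  ract1 : forall w, ract w 1 = w;
  ractM : forall w a c, ract w (a * c) = ract (ract w a) c;
  lractA : forall b w a, ract (lact b w) a = lact b (ract w a);
  lact_free : forall b w, lact b w = w -> b = 1;
  ract_free : forall w a, ract w a = w -> a = 1
}.

(* Actions are right actions in mathcomp: [bact w (b, a)] is what the left
   action (b, a).w = b w a^-1 gives at the inverse of (b, a). *)
Definition bact_fun (O : biset) (w : O) (g : gT * gT) : O :=
  lact g.1^-1 (ract w g.2).

Lemma bact_fun1 (O : biset) : @bact_fun O ^~ 1 =1 id.
Proof. by move=> w; rewrite /bact_fun /= invg1 ract1 lact1. Qed.

Lemma bact_funM (O : biset) (w : O) : act_morph (@bact_fun O) w.
Proof. by move=> g h; rewrite /bact_fun /= invMg ractM lactM lractA. Qed.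

Canonical bact (O : biset) := TotalAction (@bact_fun1 O) (@bact_funM O).

Definition borbit (O : biset) (w : O) : {set O} :=
  orbit (bact O) [set: gT * gT] w.

Definition bstab (O : biset) (w : O) : {set gT * gT} := 'C[w | bact O].

Definition embedding (Y O : biset) (f : Y -> O) : bool :=
  [&& injectiveb f,
      [forall b, [forall y, f (lact b y) == lact b (f y)]]
    & [forall y, [forall a, f (ract y a) == ract (f y) a]]].

Definition contained (Y O : biset) : bool :=
  [exists f : {ffun Y -> O}, embedding f].

Definition iso_onto (Y O : biset) (A : {set O}) : bool :=
  [exists f : {ffun Y -> O}, embedding f && (f @: [set: Y] == A)].

(* [P, phi], as the set (S x S)/(P, phi) of left cosets on which
   b.(x, y)H.a = (bx, a^-1 y)H. *)
Section Transitive.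
Variable u : mono gT.

Record tcar : Type := TCar {
  tval : {set gT * gT};
  _ : tval \in lcosets (twdiag (dom u) (mfun u)) [set: gT * gT]
}.

HB.instance Definition _ := [isSub for tval].
HB.instance Definition _ := [Countable of tcar by <:].
HB.instance Definition _ := [Finite of tcar by <:].

Lemma tshift_subproof (g : gT * gT) (C : tcar) :
  g *: val C \in lcosets (twdiag (dom u) (mfun u)) [set: gT * gT].
Proof.
case: C => /= _ /lcosetsP[x _ ->]; apply/lcosetsP.
by exists (g * x); rewrite ?inE // lcosetM.
Qed.

Definition tshift g C : tcar := Sub (g *: val C) (tshift_subproof g C).

Definition tlact (b : gT) (C : tcar) : tcar := tshift (b, 1) C.
Definition tract (C : tcar) (a : gT) : tcar := tshift (1, a^-1) C.

Lemma tshift1 C : tshift 1 C = C.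
Proof. by apply: val_inj; rewrite /= mul1g. Qed.

Lemma tshiftM g h C : tshift (g * h) C = tshift g (tshift h C).
Proof. by apply: val_inj; rewrite /= lcosetM. Qed.

Lemma tlact1 C : tlact 1 C = C. Proof. exact: tshift1. Qed.

Lemma tlactM b c C : tlact (b * c) C = tlact b (tlact c C).
Proof.
rewrite /tlact -tshiftM; congr (tshift _ C).
by apply/eqP; rewrite xpair_eqE mulg1 !eqxx.
Qed.

Lemma tract1 C : tract C 1 = C.
Proof. by rewrite /tract invg1; apply: tshift1. Qed.

Lemma tractM C a c : tract C (a * c) = tract (tract C a) c.
Proof.
rewrite /tract -tshiftM; congr (tshift _ C).
by apply/eqP; rewrite xpair_eqE mulg1 invMg !eqxx.
Qed.

Lemma tlractA b C a : tract (tlact b C) a = tlact b (tract C a).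
Proof.
rewrite /tract /tlact -!tshiftM; congr (tshift _ C).
by apply/eqP; rewrite xpair_eqE /= !mulg1 !mul1g !eqxx.
Qed.

Lemma tshift_fix (b a : gT) (C : tcar) : tshift (b, a) C = C ->
  exists x y, exists2 c, c \in dom u & b ^ x = mfun u c /\ a ^ y = c.
Proof.
move/(congr1 val) => /=; case/lcosetsP: (valP C) => [[x y] _ /= ->].
rewrite -lcosetM => eqC; exists x, y.
have: (b, a) * (x, y) \in (x, y) *: twdiag (dom u) (mfun u).
  by rewrite -eqC lcoset_refl.
rewrite mem_lcoset => /imsetP[c Pc [E1 E2]]; by exists c.
Qed.

Lemma tlact_free b C : tlact b C = C -> b = 1.
Proof.
case/tshift_fix=> x [y [c _ [E1 E2]]].
by apply: (@conjg_inj _ x); rewrite E1 conj1g -E2 conj1g mfun1.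
Qed.

Lemma tract_free C a : tract C a = C -> a = 1.
Proof.
case/tshift_fix=> x [y [c Pc [E1 E2]]].
have c1 : c = 1.
  by apply: (mfun_inj Pc (group1 _)); rewrite -E1 conj1g mfun1.
by apply: invg_inj; apply: (@conjg_inj _ y); rewrite E2 invg1 conj1g.
Qed.

Definition tbiset : biset :=
  Biset tlact1 tlactM tract1 tractM tlractA tlact_free tract_free.

End Transitive.

Variable F : fusion_system gT.

Definition generated (O : biset) : Prop :=
  forall w : O, exists (P : {group gT}) (phi : {ffun gT -> gT}),
    phi \in F P [set: gT]%G /\ bstab w = twdiag P phi.

Definition stable (O : biset) : Prop :=
  forall u eta1 eta2 : mono gT,
    misof F eta1 -> img eta1 = dom u -> misof F eta2 -> dom eta2 = img u ->
    #|'Fix_(bact O)(twdiag (dom u) (mfun u))| =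
    #|'Fix_(bact O)(twdiag (dom eta1) (mfun eta2 \o mfun u \o mfun eta1))|.

Definition characteristic (p : nat) (O : biset) : Prop :=
  [/\ generated O, stable O & ~~ (p %| #|O| %/ #|[set: gT]|)].

Definition minimal_characteristic (p : nat) (L : biset) : Prop :=
  characteristic p L /\
  (forall O : biset, characteristic p O -> contained L O).

Definition centric_part (O : biset) : {set O} :=
  [set w | ~~ [exists u : mono gT,
                 ~~ centric F (dom u) && iso_onto (tbiset u) (borbit w)]].

End Bisets.

(* Main.v *)
Require Import Defs.
From HB Require Import structures.
From mathcomp Require Import all_boot all_fingroup all_solvable.
Set Implicit Arguments.
Unset Strict Implicit.
Unset Printing Implicit Defensive.
Import GroupScope.
(* mathcomp also has a [dom] and an [mfun], for morphisms. *)
Import Defs.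

(* An F-generated F-stable biset with a point fixed by (S, id) has, by stability,
   a point fixed by (P, phi) for every phi in F(P, S), and when phi is
   nonextendable the stabilizer of that point is (P, phi) itself; so every class
   of nonextendable isomorphisms between centric subgroups contributes at least
   one orbit to Lambda.

   For the upper bound, minimality only requires one F-characteristic biset whose
   centric part is Omega_0, the disjoint union of one [P, phi] for each such
   class.  By saturation, the maximal extensions of a morphism phi from a centric
   P form a single Z(P)-conjugacy class, and (R, psi)(1 x Z(R)) is the whole
   normalizer of a maximal (R, psi); hence the points of Omega_0 fixed by
   (P, phi) form a Z(P)-torsor and Omega_0 is stable on centric subgroups.  It is
   then made stable by adding orbits [Q, psi] with Q not centric, by decreasing
   order of Q.  Writing W for the quotient of the normalizer of (Q, psi) in S x S
   by (Q, psi), the numbers of points fixed by (Q, psi) and by (Q', id), with Q'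
   fully normalized and F-conjugate to Q, are congruent modulo |W| by the
   Cauchy-Frobenius formula, because W embeds compatibly in the corresponding
   quotient for (Q', id); and adding [Q, psi] adds exactly |W| fixed points. *)

(** * Left conjugation *)

Section Conjugation.
Variable gT : finGroupType.
Implicit Types (x y g h : gT).

Lemma clJ g x : cl g x = x ^ g^-1.
Proof. by rewrite /cl conjgE invgK mulgA. Qed.

Lemma clM g h x : cl (g * h) x = cl g (cl h x).
Proof. by rewrite /cl invMg !mulgA. Qed.

Lemma cl_im g (A : {set gT}) : cl g @: A = A :^ g^-1.
Proof. by rewrite /conjugate; apply: eq_imset => x; rewrite clJ. Qed.

End Conjugation.

(** * Morphisms of a fusion system *)

Section Morphisms.
Variables (gT : finGroupType) (F : fusion_system gT).
Implicit Types (P Q R : {group gT}) (f g : gT -> gT) (u v : mono gT).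

Lemma restrE P f : {in P, restr P f =1 f}.
Proof. by move=> x Px; rewrite ffunE Px. Qed.

Lemma eq_restr P f g : {in P, f =1 g} -> restr P f = restr P g.
Proof. by move=> fg; apply/ffunP=> x; rewrite !ffunE; case: ifP => // /fg. Qed.

Lemma injhomP P Q (phi : {ffun gT -> gT}) : phi \in injhom P Q ->
  [/\ {in P &, {morph phi : x y / x * y}}, {in P &, injective phi},
      phi @: P \subset Q & restr P phi = phi].
Proof.
rewrite inE => /and3P[/pffun_onP[suppP imQ] /morphicP phiM /dinjectiveP phiI].
split=> //; first by apply/subsetP=> _ /imsetP[x Px ->]; apply/imQ/imageP; exists x.
apply/ffunP=> x; rewrite ffunE; case: ifPn => // notPx; apply/esym/eqP.
by apply: contraNT notPx => phix; apply: (subsetP suppP).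
Qed.

Lemma mem_injhom P Q f :
  {in P &, {morph f : x y / x * y}} -> {in P &, injective f} ->
  f @: P \subset Q -> restr P f \in injhom P Q.
Proof.
move=> fM fI fPQ; rewrite inE; apply/and3P; split.
- apply/pffun_onP; split.
    by apply/subsetP=> x; rewrite inE ffunE; case: ifP => // _; rewrite eqxx.
  by move=> _ /imageP[x Px ->]; rewrite restrE // (subsetP fPQ) ?imset_f.
- by apply/morphicP=> x y Px Py; rewrite !restrE ?groupM ?fM.
by apply/dinjectiveP=> x y Px Py; rewrite !restrE //; apply: fI.
Qed.

Lemma isob_im P Q (phi : {ffun gT -> gT}) : isob F P Q phi -> phi @: P = Q.
Proof.
case/andP=> Fphi /exists_inP[psi Fpsi /andP[_ /forall_inP psiK]].
have [_ _ imphi _] := injhomP (subsetP (fhom_injhom F P Q) _ Fphi).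
have [_ _ impsi _] := injhomP (subsetP (fhom_injhom F Q P) _ Fpsi).
apply/eqP; rewrite eqEsubset imphi; apply/subsetP=> y Qy.
by rewrite -(eqP (psiK _ Qy)) imset_f ?(subsetP impsi) ?imset_f.
Qed.

(** Morphisms are handled as bare functions of which only the values on P matter, so composites need
    no explicit restriction. *)
Definition fmor P f := restr P f \in F P [set: gT]%G.

(* The generated group makes this total; it is the image for f in F(P, S). *)
Definition fim P f := generated_group (f @: P).

Lemma eq_fmor P f g : {in P, f =1 g} -> fmor P f = fmor P g.
Proof. by move=> fg; rewrite /fmor (eq_restr fg). Qed.

Lemma fmorP P f : fmor P f ->
  {in P &, {morph f : x y / x * y}} /\ {in P &, injective f}.
Proof.
move/(subsetP (fhom_injhom F P _))/injhomP=> [fM fI _ _].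
split=> x y Px Py; first by have := fM x y Px Py; rewrite !restrE ?groupM.
by move=> eq_fxy; apply: fI => //; rewrite !restrE.
Qed.

Lemma fmorM P f : fmor P f -> {in P &, {morph f : x y / x * y}}.
Proof. by case/fmorP. Qed.

Lemma fmor_inj P f : fmor P f -> {in P &, injective f}.
Proof. by case/fmorP. Qed.

Lemma fmor1 P f : fmor P f -> f 1 = 1.
Proof. by move/fmorM=> fM; apply: (mulgI (f 1)); rewrite -fM ?mulg1. Qed.

Lemma fmorV P f : fmor P f -> {in P, {morph f : x / x^-1}}.
Proof.
move=> fP x Px; apply: (mulgI (f x)).
by rewrite -(fmorM fP) ?groupV // !mulgV (fmor1 fP).
Qed.

Lemma fmorJ P f : fmor P f -> {in P &, {morph f : x y / cl x y}}.
Proof.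
by move=> fP x y Px Py; rewrite /cl !(fmorM fP) ?groupM ?groupV // (fmorV fP).
Qed.

Lemma fimE P f : fmor P f -> fim P f = f @: P :> {set gT}.
Proof.
move=> fP; have gP : group_set (f @: P).
  apply/group_setP; split; first by rewrite -(fmor1 fP) imset_f.
  move=> _ _ /imsetP[x Px ->] /imsetP[y Py ->].
  by rewrite -(fmorM fP) // imset_f ?groupM.
by rewrite -[RHS]/(gval (Group gP)) -[RHS]genGid.
Qed.

Lemma fhom_fim P Q (phi : {ffun gT -> gT}) : phi \in F P Q -> isob F P (fim P phi) phi.
Proof.
case/fhom_factor=> R _ isoR; suffices -> : fim P phi = R by [].
by apply/val_inj; rewrite /= (isob_im isoR) genGid.
Qed.

(** Inclusions are restrictions of conjugation by 1, hence morphisms of F, and composing with one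
    enlarges the target. *)
Lemma fhom_sub P Q R (phi : {ffun gT -> gT}) :
  phi \in F P Q -> Q \subset R -> phi \in F P R.
Proof.
move=> Fphi sQR; have [_ _ imphi phiE] := injhomP (subsetP (fhom_injhom F P Q) _ Fphi).
have: restr Q (cl 1) \in F Q R by rewrite fhom_conj // cl_im invg1 conjsg1.
move/(fhom_comp Fphi); rewrite (_ : restr P _ = phi) // -{2}phiE.
apply: eq_restr => x Px /=.
by rewrite restrE ?clJ ?invg1 ?conjg1 // (subsetP imphi) ?imset_f.
Qed.

(** The factorization axiom makes a morphism an isomorphism onto its image, and the image can then
    be enlarged to any Q containing it. *)
Lemma fmor_hom P Q f : fmor P f -> f @: P \subset Q -> restr P f \in F P Q.
Proof.
move=> fP sfPQ; have /andP[Ff _] := fhom_fim fP; apply: fhom_sub Ff _.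
suffices -> : fim P (restr P f) = fim P f by rewrite fimE.
by apply/val_inj; rewrite /= (eq_in_imset (@restrE P f)).
Qed.

Lemma hom_fmor P Q (phi : {ffun gT -> gT}) : phi \in F P Q -> fmor P phi.
Proof.
move=> Fphi; have [_ _ _ phiE] := injhomP (subsetP (fhom_injhom F P Q) _ Fphi).
by rewrite /fmor phiE; apply: fhom_sub Fphi (subsetT _).
Qed.

Lemma fmor_comp P Q f g : fmor P f -> f @: P \subset Q -> fmor Q g -> fmor P (g \o f).
Proof.
move=> fP sfPQ gQ; have := fhom_comp (fmor_hom fP sfPQ) gQ; rewrite /fmor.
rewrite (_ : restr P _ = restr P (g \o f)) //; apply: eq_restr => x Px /=.
by rewrite !restrE // (subsetP sfPQ) ?imset_f.
Qed.

Lemma fmor_cl P (b : gT) : fmor P (cl b).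
Proof. by rewrite /fmor fhom_conj ?subsetT. Qed.

Lemma fmor_id P : fmor P id.
Proof. by rewrite -(eq_fmor (f := cl 1)) ?fmor_cl // => x _; rewrite clJ invg1 conjg1. Qed.

Lemma fmor_sub P Q f : fmor P f -> Q \subset P -> fmor Q f.
Proof.
move=> fP sQP; have -> : fmor Q f = fmor Q (f \o id) by [].
by apply: fmor_comp fP; [apply: fmor_id | rewrite imset_id].
Qed.

Lemma fmor_inv P Q f : fmor P f -> f @: P = Q ->
  exists g, [/\ fmor Q g, g @: Q = P, {in P, cancel f g} & {in Q, cancel g f}].
Proof.
move=> fP defQ.
have fQ : fim P (restr P f) = Q.
  by apply/val_inj; rewrite /= (eq_in_imset (@restrE P f)) defQ genGid.
have := fhom_fim fP; rewrite fQ => /andP[Ff /exists_inP[g gQ]].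
case/andP=> /forall_inP fK /forall_inP gK.
have imgP : g @: Q \subset P.
  by have [] := injhomP (subsetP (fhom_injhom F Q P) _ gQ).
have fK' : {in P, cancel f g} by move=> x Px; have:= eqP (fK x Px); rewrite restrE.
exists g; split=> //; first exact: hom_fmor gQ.
  apply/eqP; rewrite eqEsubset imgP; apply/subsetP=> x Px.
  by rewrite -(fK' x Px) imset_f // -defQ imset_f.
move=> y Qy; have := eqP (gK y Qy); rewrite restrE //.
by rewrite (subsetP imgP) ?imset_f.
Qed.

Lemma fisoP P Q (phi : {ffun gT -> gT}) :
  fiso F P Q phi = [&& restr P phi == phi, fmor P phi & phi @: P == Q].
Proof.
apply/idP/and3P=> [isoQ|[/eqP phiE Pphi /eqP defQ]].
  have /andP[Fphi _] := isoQ; split; last by rewrite (isob_im isoQ).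
    by have [_ _ _ ->] := injhomP (subsetP (fhom_injhom F P Q) _ Fphi).
  exact: hom_fmor Fphi.
have := fhom_fim Pphi; rewrite phiE; rewrite (_ : fim P phi = Q) //.
by apply/val_inj; rewrite /= defQ genGid.
Qed.

Lemma fconjP P Q : reflect (exists2 f, fmor P f & f @: P = Q) (fconj F P Q).
Proof.
apply: (iffP existsP) => [[phi]|[f fP defQ]].
  by rewrite fisoP => /and3P[_ Pphi /eqP <-]; exists phi.
exists (restr P f); rewrite fisoP (eq_in_imset (@restrE P f)) defQ.
rewrite (eq_fmor (@restrE P f)) fP !eqxx !andbT.
by apply/eqP/eq_restr=> x Px; rewrite restrE.
Qed.

Lemma fconj_refl P : fconj F P P.
Proof. by apply/fconjP; exists id; [apply: fmor_id | rewrite imset_id]. Qed.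

Lemma fconj_sym P Q : fconj F P Q = fconj F Q P.
Proof.
suffices sym R T : fconj F R T -> fconj F T R by apply/idP/idP; apply: sym.
by case/fconjP=> f /fmor_inv H /H[g [gT_ im _ _]]; apply/fconjP; exists g.
Qed.

Lemma fconj_trans P Q R : fconj F P Q -> fconj F Q R -> fconj F P R.
Proof.
case/fconjP=> f fP defQ /fconjP[g gQ defR]; apply/fconjP; exists (g \o f).
  by apply: fmor_comp gQ => //; rewrite defQ.
by rewrite imset_comp defQ.
Qed.

Lemma card_fconj P Q : fconj F P Q -> #|P| = #|Q|.
Proof. by case/fconjP=> f fP <-; rewrite card_in_imset //; apply: fmor_inj. Qed.

Lemma fconj_fim P f : fmor P f -> fconj F P (fim P f).
Proof. by move=> fP; apply/fconjP; exists f; rewrite ?fimE. Qed.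

Lemma fconjJ P x : fconj F P (P :^ x)%G.
Proof. by apply/fconjP; exists (cl x^-1); rewrite ?fmor_cl // cl_im invgK. Qed.

Lemma centricP P : reflect (forall Q, fconj F P Q -> 'C(Q) \subset Q) (centric F P).
Proof. exact: forall_inP. Qed.

Lemma centric_fconj P Q : fconj F P Q -> centric F P -> centric F Q.
Proof.
move=> PQ /centricP cP; apply/centricP=> R QR; apply: cP.
exact: fconj_trans PQ QR.
Qed.

(** A morphism f on Q restricts to P, and C(f(Q)) <= C(f(P)) <= f(P) <= f(Q). *)
Lemma centricS P Q : P \subset Q -> centric F P -> centric F Q.
Proof.
move=> sPQ /centricP cP; apply/centricP=> R /fconjP[f fQ defR].
have fP := fmor_sub fQ sPQ.
have sfPR : fim P f \subset R by rewrite fimE // -defR imsetS.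
exact: subset_trans (centS sfPR) (subset_trans (cP _ (fconj_fim fP)) sfPR).
Qed.

Lemma centricT : centric F [set: gT]%G.
Proof.
by apply/centricP=> R /card_fconj eqR; rewrite (_ : R = [set: gT]%G) ?subsetT //;
   apply/val_inj/eqP; rewrite eqEcard subsetT /= eqR.
Qed.

(** An element centralizing f(P) lies in f(P), because f(P) is F-conjugate to the centric P. Its
    preimage is central in P by injectivity of f. *)
Lemma cent_fmor P f y : centric F P -> fmor P f ->
  {in P, forall x, cl y (f x) = f x} -> exists2 z, z \in 'Z(P) & y = f z.
Proof.
move=> /centricP cP fP cy.
have: y \in 'C(fim P f).
  apply/centP=> w; rewrite fimE // => /imsetP[x Px ->].
  by rewrite /commute -{2}(cy x Px) /cl mulgKV.
move=> Cy; have:= subsetP (cP _ (fconj_fim fP)) _ Cy;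
rewrite fimE // => /imsetP[z Pz def_y].
exists z => //; apply/centerP; split=> // x Px; apply: (fmor_inj fP); rewrite ?groupM //.
rewrite !(fmorM fP) // -def_y; apply: (centP Cy).
by rewrite fimE ?imset_f.
Qed.

(** If f: Q -> P is an F-isomorphism then C(Q) <= Q, so f is defined on C(Q) and embeds it in
    C(P). *)
Lemma centric_fully_centralized P : centric F P -> fully_centralized F P.
Proof.
move/centricP=> cP; apply/forall_inP=> Q PQ.
have [f fQ defP] : exists2 f, fmor Q f & f @: Q = P by apply/fconjP; rewrite fconj_sym.
have sCQ := cP _ PQ; rewrite -(card_in_imset (f := f) (D := 'C(Q))); last first.
  by move=> x y Cx Cy; apply: (fmor_inj fQ); apply: (subsetP sCQ).
apply/subset_leq_card/subsetP=> _ /imsetP[x Cx ->]; apply/centP=> y.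
rewrite -defP => /imsetP[z Qz ->]; have Qx := subsetP sCQ _ Cx.
by rewrite /commute -!(fmorM fQ) // (centP Cx).
Qed.

Lemma fully_normalized_ex P : exists2 Q, fconj F P Q & fully_normalized F Q.
Proof.
have [Q PQ maxQ] := @arg_maxnP _ P (fconj F P) (fun Q => #|'N(Q)|) (fconj_refl P).
exists Q => //; apply/forall_inP=> R QR; apply: maxQ; exact: fconj_trans PQ QR.
Qed.

End Morphisms.

(** * Twisted diagonal subgroups *)

Section TwistedDiagonals.
Variables (gT : finGroupType) (F : fusion_system gT).
Implicit Types (P Q R : {group gT}) (u v w : mono gT) (g : gT * gT).

Definition tw u : {group gT * gT} := [group of twdiag (dom u) (mfun u)].

Definition Fmono u := fmor F (dom u) (mfun u).

Lemma mem_twdiag P f g : (g \in twdiag P f) = (g.2 \in P) && (g.1 == f g.2).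
Proof.
case: g => b a; apply/imsetP/andP => /= [[x Px [-> ->]]|[Pa /eqP->]] //.
by exists a.
Qed.

Lemma mem_tw u g : (g \in tw u) = (g.2 \in dom u) && (g.1 == mfun u g.2).
Proof. exact: mem_twdiag. Qed.

Lemma card_tw u : #|tw u| = #|dom u|.
Proof. by rewrite card_imset // => x y []. Qed.

Lemma mfun_restr u : restr (dom u) (mfun u) = mfun u.
Proof. by have [] := injhomP (valP u). Qed.

Lemma mono_eq u v : dom u = dom v -> {in dom u, mfun u =1 mfun v} -> u = v.
Proof.
move=> eqD eqM; apply: val_inj; apply: injective_projections => //=.
by rewrite -[LHS]mfun_restr -[RHS]mfun_restr -/(dom v) -eqD; apply: eq_restr.
Qed.

(** Extension of maps is inclusion of twisted diagonals, so maximal extensions become maximal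
    subgroups of this kind. *)
Lemma tw_subset u v :
  tw u \subset tw v -> dom u \subset dom v /\ {in dom u, mfun u =1 mfun v}.
Proof.
move=> sub; have twP x : x \in dom u -> x \in dom v /\ mfun u x = mfun v x.
  move=> Dx; have: (mfun u x, x) \in tw v by rewrite (subsetP sub) // mem_tw /= Dx eqxx.
  by rewrite mem_tw /= => /andP[-> /eqP].
by split=> [|x /twP[]//]; apply/subsetP=> x /twP[].
Qed.

Lemma subset_tw u v :
  dom u \subset dom v -> {in dom u, mfun u =1 mfun v} -> tw u \subset tw v.
Proof.
move=> sD eqM; apply/subsetP=> [[b a]]; rewrite !mem_tw /= => /andP[Da /eqP->].
by rewrite (subsetP sD) //= eqM.
Qed.

Lemma tw_inj u v : tw u = tw v :> {set _} -> u = v.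
Proof.
move=> eq_tw; have [sD eqM] : dom u \subset dom v /\ {in dom u, mfun u =1 mfun v}.
  by apply: tw_subset; rewrite eq_tw.
have [sD' _] : dom v \subset dom u /\ {in dom v, mfun v =1 mfun u}.
  by apply: tw_subset; rewrite eq_tw.
by apply: mono_eq => //; apply/val_inj/eqP; rewrite eqEsubset sD sD'.
Qed.

Lemma Fmono_ex P f : fmor F P f ->
  exists u, [/\ Fmono u, dom u = P & {in P, mfun u =1 f}].
Proof.
move=> fP; have [fM fI] := fmorP fP.
exists (@Mono gT (P, restr P f) (mem_injhom (Q := [set: gT]%G) fM fI (subsetT _))).
split=> //; last exact: restrE.
by rewrite /Fmono (eq_fmor _ (@restrE _ _ _)).
Qed.

Lemma tw_Fmono_ex P f : fmor F P f ->
  exists2 u, Fmono u & tw u = twdiag P f :> {set _}.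
Proof.
case/Fmono_ex=> u [Fu eqD eqM]; exists u => //.
apply/setP=> g; rewrite mem_tw mem_twdiag eqD.
by case: (g.2 \in P) / boolP => // /eqM->.
Qed.

(** H is the graph of the restriction of [mfun u] to the projection of H on the second factor. *)
Lemma sub_tw u (H : {group gT * gT}) : Fmono u -> H \subset tw u ->
  exists v, [/\ Fmono v, tw v = H :> {set _}, dom v \subset dom u
              & {in dom v, mfun v =1 mfun u}].
Proof.
move=> Fu sHu; pose P := (snd_morphism gT gT @* H)%G.
have sPu : P \subset dom u.
  apply/subsetP=> _ /morphimP[g _ Hg ->].
  by have := subsetP sHu _ Hg; rewrite mem_tw => /andP[].
have [v [Fv eqD eqM]] := Fmono_ex (fmor_sub Fu sPu).
exists v; split; rewrite // ?eqD //; apply/setP=> [[b a]]; rewrite mem_tw /= eqD.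
apply/andP/idP=> [[/morphimP[[b' a'] _ Hg /= def_a]]|Hg].
  have := subsetP sHu _ Hg; rewrite mem_tw -def_a /= => /andP[_ /eqP def_b'].
  rewrite eqM; last by apply/morphimP; exists (b', a'); rewrite ?inE.
  by rewrite -def_b' def_a => /eqP->.
have Pa : a \in P by apply/morphimP; exists (b, a); rewrite ?inE.
have := subsetP sHu _ Hg; rewrite mem_tw /= => /andP[_ def_b].
by rewrite eqM.
Qed.

Lemma memJ_pair (g h : gT * gT) : g ^ h = (g.1 ^ h.1, g.2 ^ h.2).
Proof. by []. Qed.

(** Conjugation by (b, a) turns phi into c_b^-1 phi c_a, which is again a morphism of F. *)
Lemma twJ u g : Fmono u -> exists v,
  [/\ Fmono v, tw v = tw u :^ g :> {set _} & dom v = dom u :^ g.2 :> {set _}].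
Proof.
case: g => b a Fu; pose f := cl b^-1 \o (mfun u \o cl a).
have fP : fmor F (dom u :^ a)%G f.
  apply: (@fmor_comp _ _ _ [set: gT]%G); rewrite ?subsetT ?fmor_cl //.
  apply: (@fmor_comp _ _ _ (dom u)) => //; first exact: fmor_cl.
  by rewrite cl_im -conjsgM mulgV conjsg1.
have [v [Fv eqD eqM]] := Fmono_ex fP; exists v; split=> //; last by rewrite eqD.
apply/setP=> [[y x]]; rewrite mem_tw mem_conjg memJ_pair mem_tw /= eqD mem_conjg.
case: (boolP (x ^ a^-1 \in dom u)) => //= Px; rewrite eqM ?mem_conjg //= /f /=.
by rewrite !clJ invgK; apply/eqP/eqP=> [->|<-]; rewrite ?conjgK ?conjgKV.
Qed.

Lemma nonextP u : Fmono u ->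
  reflect (forall v, Fmono v -> tw u \subset tw v -> v = u) (nonextendable F u).
Proof.
move=> Fu; apply: (iffP idP) => [next v Fv suv | max].
  have [sD eqM] := tw_subset suv.
  have: ~~ (dom u \proper dom v).
    apply: contra next => prop; apply/existsP; exists (dom v); rewrite prop /=.
    apply/exists_inP; exists (mfun v); first by rewrite -(mfun_restr v).
    by rewrite -(mfun_restr u); apply/eqP/eq_restr=> x /eqM.
  rewrite properE sD negbK => sD'.
  have eqD : dom v = dom u by apply/val_inj/eqP; rewrite eqEsubset sD sD'.
  by apply: mono_eq => // x; rewrite eqD => /eqM.
apply/existsP=> [[P /andP[prop /exists_inP[f fP /eqP fE]]]].
have [v [Fv eqD eqM]] := Fmono_ex (hom_fmor fP).
have sub : dom u \subset P by apply: proper_sub prop.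
have eq_vu : v = u.
  apply: max => //; apply: subset_tw; rewrite ?eqD // => x Dx.
  by rewrite eqM ?(subsetP sub) // -fE restrE.
by move: prop; rewrite -eqD eq_vu properxx.
Qed.

Lemma nonextJ u v g : Fmono u -> Fmono v -> tw v = tw u :^ g :> {set _} ->
  nonextendable F u -> nonextendable F v.
Proof.
move=> Fu Fv eq_v /(nonextP Fu) max; apply/nonextP=> // w Fw svw.
have [w' [Fw' eq_w' _]] := twJ g^-1 Fw.
have {max} eq_wu : w' = u.
  by apply: max => //; rewrite eq_w' -sub_conjg -eq_v.
apply: tw_inj; rewrite eq_v -eq_wu eq_w' -conjsgM mulVg conjsg1 //.
Qed.

Lemma max_ext_ex u : Fmono u ->
  exists v, [/\ Fmono v, nonextendable F v & tw u \subset tw v].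
Proof.
move=> Fu; pose Q v := Fmono v && (tw u \subset tw v).
have Qu : Q u by rewrite /Q Fu /=.
have [v /andP[Fv suv] max] := @arg_maxnP _ u Q (fun v => #|tw v|) Qu.
exists v; split=> //; apply/nonextP=> // w Fw svw.
apply/esym/tw_inj/eqP; rewrite eqEcard svw; apply: max.
by rewrite /Q Fw (subset_trans suv).
Qed.

Lemma img_fconj u : Fmono u -> fconj F (dom u) (img u).
Proof. by move=> Fu; apply/fconjP; exists (mfun u). Qed.

Lemma misofE u : misof F u = Fmono u.
Proof. by rewrite /misof fisoP mfun_restr !eqxx andbT. Qed.

Lemma mem_norm_tw u g :
  {in dom u, forall a, (mfun u a, a) ^ g \in tw u} -> g \in 'N(tw u).
Proof.
move=> stab_u; rewrite inE; apply/subsetP=> _ /imsetP[[b a] tw_ba ->].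
have := tw_ba : (b, a) \in tw u.
by rewrite mem_tw /= => /andP[Da /eqP->]; apply: stab_u.
Qed.

(** If (b, a) normalizes the graph of phi then phi c_a = c_b phi on P, and this equation is the one
    defining N_phi. *)
Lemma norm_tw u g : Fmono u -> g \in 'N(tw u) ->
  [/\ g.2 \in extender u, g.1 \in 'N(img u)
    & {in dom u, forall x, mfun u (cl g.2 x) = cl g.1 (mfun u x)}].
Proof.
move=> Fu Ng.
have clP x : x \in dom u ->
    cl g.2 x \in dom u /\ mfun u (cl g.2 x) = cl g.1 (mfun u x).
  move=> Dx; have: (mfun u x, x) ^ g^-1 \in tw u.
    by rewrite memJ_norm ?groupV // mem_tw /= Dx eqxx.
  by rewrite memJ_pair mem_tw /= -!clJ => /andP[-> /eqP->].
have N2 : g.2 \in 'N(dom u).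
  rewrite -groupV inE; apply/subsetP=> _ /imsetP[x Dx ->].
  by rewrite -clJ; case: (clP x Dx).
have N1 : g.1 \in 'N(img u).
  rewrite -groupV inE; apply/subsetP=> _ /imsetP[_ /imsetP[x Dx ->] ->].
  by rewrite -clJ; case: (clP x Dx) => Dy <-; rewrite imset_f.
have eqg : {in dom u, forall x, mfun u (cl g.2 x) = cl g.1 (mfun u x)}.
  by move=> x /clP[].
split=> //; rewrite inE N2; apply/exists_inP; exists g.1 => //.
by apply/forall_inP=> x /eqg->.
Qed.

End TwistedDiagonals.

(** * Extensions of morphisms between centric subgroups *)

Section Saturation.
Variables (p : nat) (gT : finGroupType) (F : fusion_system gT).
Hypothesis pS : p.-group [set: gT].
Hypothesis satF : saturated F p.
Implicit Types (P Q R N : {group gT}) (u v : mono gT).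

Lemma group_set_AutF P : group_set (AutF F P).
Proof.
apply/group_setP; split.
  apply/setIdP; split; [exact: group1 | apply: fmor_hom].
    by rewrite (eq_fmor _ (g := id)) ?fmor_id // => x _; rewrite perm1.
  by apply/subsetP=> _ /imsetP[x Px ->]; rewrite perm1.
move=> s t /setIdP[As Fs] /setIdP[At Ft]; apply/setIdP; split; first exact: groupM.
have -> : restr P (s * t) = restr P (restr P t \o restr P s).
  apply: eq_restr => x Px; rewrite /= permM !restrE //.
  by rewrite Aut_closed.
exact: fhom_comp Fs Ft.
Qed.

Canonical AutF_group P := Group (group_set_AutF P).

Lemma fmor_perm P f : fmor F P f -> f @: P = P ->
  exists2 s, s \in AutF F P & {in P, s =1 f}.
Proof.
move=> fP imf; pose m := Morphism (fmorM fP).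
have injm : 'injm m by apply/injmP; apply: fmor_inj fP.
have im_m : m @* P = P by rewrite morphimEdom.
exists (aut injm im_m); last exact: autE.
apply/setIdP; split; [exact: Aut_aut | apply: fmor_hom].
  by rewrite (eq_fmor _ (g := f)) // => x Px; rewrite autE.
by apply/subsetP=> _ /imsetP[x Px ->]; rewrite autE //= -imf imset_f.
Qed.

Lemma AutF_fmor P s : s \in AutF F P -> fmor F P s /\ s @: P = P.
Proof.
case/setIdP=> As Fs; split; first by apply: fhom_sub Fs (subsetT _).
apply/eqP; rewrite eqEcard card_imset ?leqnn ?andbT; last exact: perm_inj.
by apply/subsetP=> _ /imsetP[x Px ->]; rewrite Aut_closed.
Qed.

(** An F-isomorphism f: P -> Q carries B to a p-subgroup of Aut_F(Q). As Aut_S(Q) is Sylow there,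
    some t in Aut_F(Q) conjugates that subgroup into Aut_S(Q), and c is t f. *)
Lemma sylow_transport P Q (B : {group {perm gT}}) :
  fully_normalized F Q -> fconj F P Q -> p.-group B -> B \subset AutF F P ->
  exists c, [/\ fmor F P c, c @: P = Q
    & forall s : {perm gT}, s \in B ->
        exists2 h, h \in 'N(Q) & {in P, forall x, c (s x) = cl h (c x)}].
Proof.
move=> fnQ /fconjP[f fP imf] pB sBA; pose m := Morphism (fmorM fP).
have injm : 'injm m by apply/injmP; apply: fmor_inj fP.
have im_m : m @* P = Q by rewrite morphimEdom.
pose J := Aut_isom_morphism injm (subxx P).
have sBP : B \subset Aut P by apply: subset_trans sBA _; apply/subsetP=> s /setIdP[].
have [_ sylQ] := satF.1 Q fnQ.
have sJB : J @* B \subset AutF F Q.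
  apply/subsetP=> _ /morphimP[s As Bs ->].
  have [Fs ims] := AutF_fmor (subsetP sBA _ Bs).
  have [g [gQ img gK Kg]] := fmor_inv fP imf.
  have JE y : y \in Q -> J s y = f (s (g y)).
    move=> Qy; have Pgy : g y \in P by rewrite -img imset_f.
    by rewrite -{1}(Kg _ Qy); apply: (Aut_isomE injm (subxx P) As Pgy).
  apply/setIdP; split.
    by have := Aut_Aut_isom injm (subxx P) s; rewrite im_m.
  apply: fmor_hom.
    rewrite (eq_fmor _ (g := f \o (s \o g))) //.
    apply: (fmor_comp (Q := P)) => //; last by rewrite imset_comp img ims.
    by apply: (fmor_comp (Q := P)) => //; rewrite img.
  apply/subsetP=> _ /imsetP[y Qy ->]; rewrite JE // -imf imset_f //.
  by rewrite -ims imset_f // -img imset_f.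
have pJB : p.-group (J @* B) by apply: morphim_pgroup.
have [t At sJt] := Sylow_Jsub (G := AutF_group Q) (P := (conj_aut Q @* 'N(Q))%G)
  (Q := (J @* B)%G) sylQ sJB pJB.
have [Ft imt] := AutF_fmor At.
exists (t \o f); split.
- by apply: (fmor_comp (Q := Q)); rewrite ?imf.
- by rewrite imset_comp imf imt.
move=> s Bs; have As := subsetP sBP _ Bs.
have: J s ^ t \in conj_aut Q @* 'N(Q).
  by rewrite (subsetP sJt) // memJ_conjg mem_morphim.
(* The inverse appears because [conj_aut] is right conjugation and [cl] left conjugation. *)
case/morphimP=> h _ Nh eqh; exists h^-1; rewrite ?groupV // => x Px /=.
have Qfx : t (f x) \in Q by rewrite -imt -imf !imset_f.
rewrite clJ invgK -(norm_conj_autE Nh) // -eqh conjgE !permM permK.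
by congr (t _); apply/esym/(Aut_isomE injm (subxx P) As).
Qed.

(** The composite a = f1^-1 f2 is an automorphism of N, trivial on P, that multiplies each element
    by one of Z(P). It has p-power order, so some c carries it to conjugation by an element h of S;
    h centralizes c(P) and is therefore c(z) with z in Z(P). *)
Lemma centric_ext_unique P N f1 f2 : centric F P -> P <| N ->
  fmor F N f1 -> fmor F N f2 -> {in P, f1 =1 f2} ->
  exists2 z, z \in 'Z(P) & {in N, forall x, f2 x = f1 (cl z x)}.
Proof.
move=> cenP /andP[sPN nPN] f1N f2N eqP12.
have f1P := fmor_sub f1N sPN.
have diff g : g \in N -> exists2 z, z \in 'Z(P) & f2 g = f1 (g * z).
  move=> Ng; have [z Zz def_y] : exists2 z, z \in 'Z(P) & (f1 g)^-1 * f2 g = f1 z.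
    apply: cent_fmor cenP f1P _ => x Px.
    have Nx := subsetP sPN x Px.
    have Pgx : cl g x \in P by rewrite clJ memJ_norm ?groupV ?(subsetP nPN).
    rewrite clM {1}(eqP12 x Px) -(fmorJ f2N) // -(eqP12 _ Pgx) (fmorJ f1N) //.
    by rewrite -clM mulVg clJ invg1 conjg1.
  have Nz : z \in N by rewrite (subsetP sPN) //; case/setIP: Zz.
  by exists z; rewrite ?(fmorM f1N) // -def_y mulKVg.
have [k [kR imk f1K kK]] := fmor_inv f1N (esym (fimE f1N)).
pose a := k \o f2.
have ZN z : z \in 'Z(P) -> z \in N by case/setIP=> Pz _; apply: (subsetP sPN).
have im2 : f2 @: N \subset fim N f1.
  apply/subsetP=> _ /imsetP[g Ng ->]; have [z /ZN Nz ->] := diff g Ng.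
  by rewrite (fimE f1N) imset_f ?groupM.
have aN : fmor F N a by apply: fmor_comp kR.
have aE g : g \in N -> exists2 z, z \in 'Z(P) & a g = g * z.
  move=> Ng; have [z Zz eqz] := diff g Ng; exists z => //.
  by rewrite /a /= eqz f1K // groupM // ZN.
have aP x : x \in P -> a x = x.
  by move=> Px; rewrite /a /= -eqP12 // f1K // (subsetP sPN).
have ima : a @: N = N.
  apply/eqP; rewrite eqEcard card_in_imset ?leqnn ?andbT; last exact: fmor_inj aN.
  apply/subsetP=> _ /imsetP[g Ng ->]; have [z /ZN Nz ->] := aE g Ng.
  by rewrite groupM.
have [s As sE] := fmor_perm aN ima.
(* Since [a] fixes z, [s ^+ n] sends g to g * z ^+ n; hence the order of [s] divides |S|. *)
have p_s : p.-group <[s]>.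
  apply: pnat_dvd pS; rewrite order_dvdn; apply/eqP/permP=> g.
  rewrite perm1; case: (boolP (g \in N)) => [Ng | notNg]; last first.
    rewrite permX; elim: #|_| => //= n ->; apply: out_Aut notNg.
    by case/setIdP: As.
  have [z Zz agz] := aE g Ng; have Nz := ZN z Zz.
  suffices sX n : (s ^+ n) g = g * z ^+ n.
    by rewrite sX (_ : z ^+ _ = 1) ?mulg1 //; apply/eqP; rewrite -order_dvdn order_dvdG ?inE.
  rewrite permX; elim: n => [|n IHn]; first by rewrite expg0 mulg1.
  rewrite iterS IHn sE ?groupM ?groupX // (fmorM aN) ?groupX //.
  by rewrite agz aP ?groupX -?mulgA -?expgS //; case/setIP: Zz.
have [Q NQ fnQ] := fully_normalized_ex F N.
have sA : <[s]> \subset AutF F N by rewrite (cycle_subG s (AutF_group N)).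
have [c [cN imc cB]] := sylow_transport fnQ NQ p_s sA.
have [h Nh ch] := cB s (cycle_id s).
have cP := fmor_sub cN sPN.
have [z Zz def_h] : exists2 z, z \in 'Z(P) & h = c z.
  apply: cent_fmor cenP cP _ => x Px; have Nx := subsetP sPN x Px.
  by rewrite -ch // sE // aP.
exists z => // x Nx; have Nz := ZN z Zz.
have Nzx : cl z x \in N by rewrite /cl !groupM ?groupV.
have Nax : a x \in N by rewrite -ima imset_f.
have <- : a x = cl z x.
  by apply: (fmor_inj cN) => //; rewrite -sE // ch // (fmorJ cN) // def_h.
by rewrite kK // (subsetP im2) ?imset_f.
Qed.

Lemma extension u : Fmono F u -> fully_centralized F (img u) ->
  exists v, [/\ Fmono F v, tw u \subset tw v & dom v = extender u :> {set gT}].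
Proof.
move=> Fu fc; have [|psi psiF eq_psi] := satF.2 u _ fc.
  by rewrite -(mfun_restr u).
have [v [Fv eqD eqM]] := Fmono_ex (hom_fmor psiF).
have sub : dom u \subset extender u.
  apply/subsetP=> x Dx; have twx : (mfun u x, x) \in tw u by rewrite mem_tw /= Dx eqxx.
  by case: (norm_tw Fu (subsetP (normG _) _ twx)).
exists v; split; rewrite ?eqD //; apply: subset_tw; rewrite ?eqD // => x Dx.
by rewrite eqM ?(subsetP sub) // -eq_psi restrE.
Qed.

(** Induction on the index of the source P: a maximal extension agrees with the extension to N_phi,
    up to Z(P), on a subgroup strictly larger than P. *)
Lemma max_ext_conj u v1 v2 : Fmono F u -> Fmono F v1 -> Fmono F v2 ->
    centric F (dom u) -> nonextendable F v1 -> nonextendable F v2 ->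
    tw u \subset tw v1 -> tw u \subset tw v2 ->
  exists2 z, z \in 'Z(dom u) & tw v2 = tw v1 :^ (1, z) :> {set _}.
Proof.
have [n] := ubnP (#|[set: gT]| - #|dom u|); elim: n => // n IHn in u v1 v2 *.
rewrite ltnS => le_n Fu F1 F2 cenu next1 next2 su1 su2.
have triv v : nonextendable F u -> Fmono F v -> tw u \subset tw v -> v = u.
  by move/(nonextP Fu); apply.
case: (boolP (nonextendable F u)) => [nextu | extu].
  exists 1; first exact: group1.
  by rewrite (triv v1) // (triv v2) // conjsg1.
have [e [Fe sue domE]] := extension Fu
  (centric_fully_centralized (centric_fconj (img_fconj Fu) cenu)).
(* The reference [m] is a maximal extension of [e]; both [v1] and [v2] are compared with it. *)
have [m [Fm nextm sem]] := max_ext_ex Fe.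
have main v : Fmono F v -> nonextendable F v -> tw u \subset tw v ->
    exists2 z, z \in 'Z(dom u) & tw m = tw v :^ (1, z) :> {set _}.
  move=> Fv nextv suv; have [sDv eqMv] := tw_subset suv.
  (* Normalizers grow in p-groups, so N is strictly larger than the source of [u], which makes the
     induction progress. *)
  pose N := 'N_(dom v)(dom u)%G : {group gT}.
  have prop : dom u \proper N.
    rewrite nilpotent_proper_norm //.
      exact: pgroup_nil (pgroupS (subsetT _) pS).
    rewrite properE sDv; apply: contra extu => sDv'.
    suffices <- : v = u by [].
    have eqD : dom v = dom u by apply/val_inj/eqP; rewrite eqEsubset sDv sDv'.
    by apply: mono_eq => // x; rewrite eqD => /eqMv.
  have sPN := proper_sub prop.
  have sNv : N \subset dom v by apply: subsetIl.
  have sNe : N \subset dom e.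
    rewrite domE; apply/subsetP=> x /setIP[Dx Nx].
    have Nxx : (mfun v x, x) \in 'N(tw u).
      rewrite -groupV; apply: mem_norm_tw => a Da.
      have Dax : a ^ x^-1 \in dom u by rewrite memJ_norm ?groupV.
      rewrite memJ_pair mem_tw /= Dax !eqMv //.
      by have Dva := subsetP sDv a Da; rewrite -!clJ (fmorJ Fv) //= eqxx.
    by case: (norm_tw Fu Nxx).
  have [_ eqMe] := tw_subset sue.
  have nPN : dom u <| N by rewrite /normal sPN subsetIr.
  have eqev : {in dom u, mfun v =1 mfun e} by move=> x Dx; rewrite -eqMv // eqMe.
  (* On N the maps [v] and [e] differ by conjugation by z, so twisting [v] by (1, z) makes it agree
     there with [e], hence with [m]. *)
  have [z Zz eqz] :=
    centric_ext_unique cenu nPN (fmor_sub Fv sNv) (fmor_sub Fe sNe) eqev.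
  have [t [Ft twt domt]] := twJ (1, z) Fv.
  have [w [Fw domw eqMw]] := Fmono_ex (fmor_sub Fe sNe).
  have [Pz _] := setIP Zz.
  have Nz : z \in N by apply: (subsetP sPN).
  have [sDem eqMem] := tw_subset sem.
  have le_w : #|[set: gT]| - #|dom w| < n.
    rewrite domw; apply: leq_trans le_n; have lt_uN := proper_card prop.
    by rewrite ltn_sub2l // (leq_trans lt_uN) // subset_leq_card ?subsetT.
  have cenw : centric F (dom w) by rewrite domw; apply: centricS cenu.
  have swt : tw w \subset tw t.
    apply/subsetP=> [[b a]]; rewrite mem_tw twt domw /= => /andP[Na /eqP->].
    have Naz : a ^ z^-1 \in N by rewrite groupJ ?groupV.
    rewrite mem_conjg memJ_pair mem_tw /= (subsetP sNv) //= eqMw // eqz // clJ.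
    by rewrite invg1 conjg1.
  have swm : tw w \subset tw m.
    apply: subset_tw; rewrite ?domw; first exact: subset_trans sNe sDem.
    by move=> x Nx; rewrite eqMw // eqMem // (subsetP sNe).
  have [y Zy eqy] := IHn w t m le_w Fw Ft Fm cenw (nonextJ Fv Ft twt nextv) nextm swt swm.
  exists (z * y); last first.
    have -> : (1, z * y) = (1, z) * (1, y) :> gT * gT by congr (_, _); rewrite mulg1.
    by rewrite eqy twt -conjsgM.
  (* The induction gives y in Z(N); it centralizes P, so it lies in Z(P) by centricity. *)
  rewrite groupM //; have [_ Cy] := setIP Zy.
  have Cuy : y \in 'C(dom u) by rewrite (subsetP (centS _) _ Cy) // domw.
  by rewrite inE Cuy (subsetP (centricP _ _ cenu _ (fconj_refl _ _))).
have [z1 Zz1 eq1] := main v1 F1 next1 su1.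
have [z2 Zz2 eq2] := main v2 F2 next2 su2.
exists (z1 * z2^-1); first by rewrite groupM ?groupV.
have -> : (1, z1 * z2^-1) = (1, z1) * (1, z2)^-1 :> gT * gT.
  by congr (_, _); rewrite mulgV.
by rewrite conjsgM -eq1 eq2 -conjsgM mulgV conjsg1.
Qed.

(** By maximality the extension to N_phi is phi itself, so N_phi = P and the second coordinate a of
    g lies in P. Then phi(a)^-1 b centralizes phi(P), b being the first coordinate, and centricity
    makes it phi(z). *)
Lemma norm_tw_max u g : Fmono F u -> centric F (dom u) -> nonextendable F u ->
  g \in 'N(tw u) -> exists2 z, z \in 'Z(dom u) & g * (1, z) \in tw u.
Proof.
move=> Fu cenu nextu Ng; have [Eg N1 eqg] := norm_tw Fu Ng.
have [e [Fe sue domE]] := extension Fu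
  (centric_fully_centralized (centric_fconj (img_fconj Fu) cenu)).
have eq_eu : e = u by move: nextu => /(nonextP Fu); apply.
have Dg : g.2 \in dom u by rewrite -eq_eu domE.
have [z Zz def_z] : exists2 z, z \in 'Z(dom u) & (mfun u g.2)^-1 * g.1 = mfun u z.
  apply: (cent_fmor cenu Fu) => x Dx.
  rewrite clM -eqg // (fmorJ Fu) // -clM mulVg.
  by rewrite clJ invg1 conjg1.
exists z => //; have [Dz _] := setIP Zz.
by rewrite mem_tw /= groupM // mulg1 (fmorM Fu) // -def_z mulKVg eqxx.
Qed.

End Saturation.

(** * Bisets *)

Section BisetTheory.
Variable gT : finGroupType.
Implicit Types (A B O : biset gT) (u v : mono gT) (H : {group gT * gT}).

Lemma borbitP O (w w' : O) : reflect (exists g, bact O w g = w') (w' \in borbit w).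
Proof.
by apply: (iffP orbitP) => [[g _]|[g]]; exists g; rewrite ?inE.
Qed.

Lemma mem_bstab O (w : O) g : (g \in bstab w) = (bact O w g == w).
Proof. by apply/astab1P/eqP. Qed.

Lemma bstabJ O (w : O) g : bstab (bact O w g) = bstab w :^ g.
Proof. exact: astab1_act. Qed.

Lemma mem_fix O (w : O) (K : {set gT * gT}) :
  (w \in 'Fix_(bact O)(K)) = (K \subset bstab w).
Proof. by rewrite sub_astab1. Qed.

Lemma card_fixJ O (K : {set gT * gT}) g :
  #|'Fix_(bact O)(K :^ g)| = #|'Fix_(bact O)(K)|.
Proof.
suffices le (K' : {set gT * gT}) h : #|'Fix_(bact O)(K')| <= #|'Fix_(bact O)(K' :^ h)|.
  by apply/eqP; rewrite eqn_leq (le K g) andbT -{2}(conjsgK g K) le.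
rewrite -(card_imset _ (act_inj (bact O) h)); apply/subset_leq_card/subsetP.
by move=> _ /imsetP[w fixw ->]; move: fixw; rewrite !mem_fix bstabJ conjSg.
Qed.

(** * The empty biset and disjoint unions *)

Definition bempty : biset gT :=
  @Biset gT void (fun _ w => w) (fun w _ => w) (fun=> erefl) (fun _ _ _ => erefl)
    (fun=> erefl) (fun _ _ _ => erefl) (fun _ _ _ => erefl)
    (fun _ w => match w with end) (fun w => match w with end).

Section Sum.
Variables A B : biset gT.

Definition sum_lact (b : gT) (w : A + B) : A + B :=
  match w with inl x => inl (lact b x) | inr y => inr (lact b y) end.
Definition sum_ract (w : A + B) (a : gT) : A + B :=
  match w with inl x => inl (ract x a) | inr y => inr (ract y a) end.

Lemma sum_lact1 w : sum_lact 1 w = w.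
Proof. by case: w => w /=; rewrite lact1. Qed.
Lemma sum_lactM b c w : sum_lact (b * c) w = sum_lact b (sum_lact c w).
Proof. by case: w => w /=; rewrite lactM. Qed.
Lemma sum_ract1 w : sum_ract w 1 = w.
Proof. by case: w => w /=; rewrite ract1. Qed.
Lemma sum_ractM w a c : sum_ract w (a * c) = sum_ract (sum_ract w a) c.
Proof. by case: w => w /=; rewrite ractM. Qed.
Lemma sum_lractA b w a : sum_ract (sum_lact b w) a = sum_lact b (sum_ract w a).
Proof. by case: w => w /=; rewrite lractA. Qed.
Lemma sum_lact_free b w : sum_lact b w = w -> b = 1.
Proof. by case: w => w [] /lact_free. Qed.
Lemma sum_ract_free w a : sum_ract w a = w -> a = 1.
Proof. by case: w => w [] /ract_free. Qed.

Definition bsum : biset gT :=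
  @Biset gT (A + B)%type sum_lact sum_ract sum_lact1 sum_lactM sum_ract1
    sum_ractM sum_lractA sum_lact_free sum_ract_free.

Lemma bact_inl (w : A) g : bact bsum (inl w) g = inl (bact A w g).
Proof. by []. Qed.

Lemma bact_inr (w : B) g : bact bsum (inr w) g = inr (bact B w g).
Proof. by []. Qed.

Lemma bstab_inl (w : A) : bstab (inl w : bsum) = bstab w.
Proof. by apply/setP=> g; rewrite !mem_bstab bact_inl. Qed.

Lemma bstab_inr (w : B) : bstab (inr w : bsum) = bstab w.
Proof. by apply/setP=> g; rewrite !mem_bstab bact_inr. Qed.

Lemma card_fix_bsum (K : {set gT * gT}) :
  #|'Fix_(bact bsum)(K)| = (#|'Fix_(bact A)(K)| + #|'Fix_(bact B)(K)|)%N.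
Proof.
rewrite -!sum1_card big_sumType; congr (_ + _)%N; apply: eq_bigl => w.
  by rewrite !mem_fix bstab_inl.
by rewrite !mem_fix bstab_inr.
Qed.

End Sum.

Lemma embedding_bact A B (f : A -> B) : embedding f ->
  forall w g, f (bact A w g) = bact B (f w) g.
Proof.
case/and3P=> _ /forallP fl /forallP fr w g.
have /forallP fl' := fl g.1^-1; have /forallP fr' := fr w.
by rewrite /= /bact_fun (eqP (fl' _)) (eqP (fr' _)).
Qed.

Lemma embedding_inj A B (f : A -> B) : embedding f -> injective f.
Proof. by case/and3P=> /injectiveP. Qed.

Lemma bstab_embedding A B (f : A -> B) : embedding f ->
  forall w, bstab (f w) = bstab w.
Proof.
move=> emb w; apply/setP=> g; rewrite !mem_bstab -(embedding_bact emb).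
exact/inj_eq/embedding_inj.
Qed.

(** * Transitive bisets *)

Section Transitive.
Variable u : mono gT.

Lemma tbase_subproof : gval (tw u) \in lcosets (twdiag (dom u) (mfun u)) [set: gT * gT].
Proof. by apply/lcosetsP; exists 1; rewrite ?inE ?mul1g. Qed.

Definition tbase : tbiset u := TCar tbase_subproof.

Lemma bact_tbiset (C : tbiset u) g : bact (tbiset u) C g = tshift g^-1 C.
Proof.
rewrite /= /bact_fun /= /tlact /tract -tshiftM; congr (tshift _ C).
by apply/eqP; rewrite xpair_eqE /= mulg1 mul1g !eqxx.
Qed.

Lemma tbase_trans (C : tbiset u) : exists g, C = bact (tbiset u) tbase g.
Proof.
case: C => C CP; have /lcosetsP[x _ defC] := CP; exists x^-1.
by apply: val_inj; rewrite bact_tbiset invgK.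
Qed.

Lemma bstab_tbase : bstab tbase = tw u.
Proof.
apply/setP=> g; rewrite mem_bstab bact_tbiset -val_eqE /= -[RHS]groupV.
apply/eqP/idP=> [eqg|]; first by have := lcoset_refl (tw u) g^-1; rewrite /= eqg.
exact: (@lcoset_id _ (tw u)).
Qed.

Lemma bstab_tbiset (C : tbiset u) : exists g, bstab C = tw u :^ g.
Proof. by have [g ->] := tbase_trans C; exists g; rewrite bstabJ bstab_tbase. Qed.

(** The fixed points are the translates of the base coset by the normalizer, and the base coset has
    stabilizer (P, phi). *)
Lemma card_fix_tbiset : #|'Fix_(bact (tbiset u))(tw u)| = #|'N(tw u) : tw u|.
Proof.
have -> : 'Fix_(bact (tbiset u))(tw u) = orbit (bact (tbiset u)) 'N(tw u) tbase.
  apply/setP=> C; rewrite mem_fix; have [g ->] := tbase_trans C.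
  rewrite bstabJ bstab_tbase; apply/idP/orbitP=> [sub|[h Nh eqh]].
    by exists g => //; rewrite -groupV inE sub_conjg invgK.
  by rewrite -bstab_tbase -bstabJ -eqh bstabJ bstab_tbase (normP Nh).
rewrite card_orbit; congr #|_ : _|; apply/setP=> g; rewrite inE.
rewrite -[X in _ && X]/(g \in bstab tbase) bstab_tbase andb_idl //.
exact/subsetP/normG.
Qed.

Lemma iso_ontoP O (w : O) :
  reflect (exists2 w', w' \in borbit w & bstab w' = tw u) (iso_onto (tbiset u) (borbit w)).
Proof.
apply: (iffP existsP) => [[f /andP[emb /eqP imf]]|[w' w'w stw']].
  exists (f tbase); first by rewrite -imf imset_f.
  by rewrite (bstab_embedding emb) bstab_tbase.
have eqo : borbit w' = borbit w := orbit_eqP w'w.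
(* A coset x(P, phi) is sent to w' moved by x^-1; the stabilizer of w' being (P, phi), the choice of
   x is immaterial. *)
pose f (C : tbiset u) := bact O w' (repr (val C))^-1.
have fE (C : tbiset u) x : val C = x *: tw u -> f C = bact O w' x^-1.
  move=> defC; rewrite /f defC.
  have /lcosetP[h Hh ->] : repr (x *: tw u) \in x *: tw u.
    by apply: mem_repr (lcoset_refl _ _).
  rewrite invMg actM; congr (bact O _ _); apply/eqP.
  by rewrite -mem_bstab stw' groupV.
have valE (C : tbiset u) : exists x, val C = x *: tw u.
  by case: C => C /= /lcosetsP[x _ ->]; exists x.
have f_shift g C : f (tshift g C) = bact O (f C) g^-1.
  have [x defC] := valE C; rewrite (fE _ _ defC) (fE _ (g * x)).
    by rewrite invMg actM.
  by rewrite /= defC lcosetM.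
exists [ffun C => f C]; apply/andP; split; last first.
  apply/eqP/setP=> y; apply/imsetP/idP=> [[C _ ->]|].
    by rewrite ffunE -eqo; apply/borbitP; exists (repr (val C))^-1.
  rewrite -eqo => /borbitP[g <-].
  exists (tshift g^-1 tbase); rewrite ?inE // ffunE f_shift invgK.
  by rewrite (fE _ 1) ?mul1g // invg1 act1.
apply/and3P; split.
- apply/injectiveP=> C D; rewrite !ffunE; have [x defC] := valE C; have [y defD] := valE D.
  rewrite (fE _ _ defC) (fE _ _ defD) => eqxy; apply: val_inj; rewrite /= defC defD.
  apply/lcoset_eqP; rewrite mem_lcoset -stw' -groupV mem_bstab invMg invgK.
  by rewrite actM eqxy -actM mulVg act1.
- apply/forallP=> b; apply/forallP=> C; rewrite !ffunE f_shift.
  have -> : (b, 1)^-1 = (b^-1, 1) :> gT * gT by congr (_, _); rewrite invg1.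
  by rewrite /= /bact_fun /= invgK ract1.
- apply/forallP=> C; apply/forallP=> a; rewrite !ffunE f_shift.
  have -> : (1, a^-1)^-1 = (1, a) :> gT * gT by congr (_, _); rewrite ?invgK ?invg1.
  by rewrite /= /bact_fun /= invg1 lact1.
Qed.

End Transitive.

End BisetTheory.

(** * Bisets with prescribed centric part *)

Section CentricPart.
Variables (p : nat) (gT : finGroupType) (F : fusion_system gT).
Hypothesis pS : p.-group [set: gT].
Hypothesis satF : saturated F p.
Implicit Types (A B O : biset gT) (P Q : {group gT}) (u v : mono gT) (H : {group gT * gT}).

Definition Fgenerated O := forall w : O, exists2 u, Fmono F u & bstab w = tw u.

Lemma generatedE O : generated F O <-> Fgenerated O.
Proof.
split=> genO w; last first.
  have [u Fu stw] := genO w; exists (dom u), (mfun u); split=> //.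
  by rewrite -(mfun_restr u).
have [P [phi [Fphi stw]]] := genO w.
by have [u Fu twu] := tw_Fmono_ex (hom_fmor Fphi); exists u; rewrite // twu.
Qed.

(* [thin O] bounds the centric part of O from above by Omega_0; [nice O] makes it
   isomorphic to Omega_0. *)
Definition thin O :=
  [/\ Fgenerated O,
      forall (w : O) u, Fmono F u -> centric F (dom u) -> bstab w = tw u ->
        nonextendable F u
    & forall (w w' : O) u, Fmono F u -> centric F (dom u) ->
        bstab w = tw u -> bstab w' = tw u -> w' \in borbit w].

Definition nice O := thin O /\
  forall u, Fmono F u -> centric F (dom u) -> nonextendable F u ->
    exists w : O, bstab w = tw u.

Lemma gen_tbiset v : Fmono F v -> Fgenerated (tbiset v).
Proof.
move=> Fv w; have [g stw] := bstab_tbiset w.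
by have [u [Fu eq_u _]] := twJ g Fv; exists u; rewrite // stw.
Qed.

Lemma gen_bsum A B : Fgenerated A -> Fgenerated B -> Fgenerated (bsum A B).
Proof. by move=> gA gB [] w; rewrite ?bstab_inl ?bstab_inr. Qed.

Lemma borbit_tbiset v (w w' : tbiset v) u :
  bstab w = tw u -> bstab w' = tw u -> w' \in borbit w.
Proof.
move=> _ _; have [g ->] := tbase_trans w; have [h ->] := tbase_trans w'.
by apply/borbitP; exists (g^-1 * h); rewrite -actM mulKVg.
Qed.

Lemma borbit_inl A B (w w' : A) :
  w' \in borbit w -> (inl w' : bsum A B) \in borbit (inl w : bsum A B).
Proof. by case/borbitP=> g <-; apply/borbitP; exists g. Qed.

Lemma borbit_inr A B (w w' : B) :
  w' \in borbit w -> (inr w' : bsum A B) \in borbit (inr w : bsum A B).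
Proof. by case/borbitP=> g <-; apply/borbitP; exists g. Qed.

Lemma twJ_dom u v g : tw v = tw u :^ g :> {set _} -> dom v = (dom u :^ g.2)%G.
Proof.
move=> eqv; apply/val_inj/setP=> x; rewrite /= mem_conjg.
apply/idP/idP=> [Dx | Dxg].
  have: (mfun v x, x) \in tw v by rewrite mem_tw /= Dx eqxx.
  by rewrite eqv mem_conjg memJ_pair mem_tw /= => /andP[].
have: (mfun u (x ^ g.2^-1), x ^ g.2^-1) ^ g \in tw v.
  by rewrite eqv memJ_conjg mem_tw /= Dxg eqxx.
by rewrite memJ_pair mem_tw /= conjgKV => /andP[].
Qed.

Lemma centricJ u v g : tw v = tw u :^ g :> {set _} ->
  centric F (dom v) = centric F (dom u).
Proof.
move/twJ_dom->; apply/idP/idP; apply: centric_fconj; last exact: fconjJ.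
by rewrite fconj_sym fconjJ.
Qed.

(** When the source of [u] is centric, no stabilizer in O is conjugate to [tw u], so a point of O
    and a point of the new orbit never share a stabilizer with centric source. *)
Lemma thin_bsum O u : thin O -> Fmono F u ->
    (centric F (dom u) ->
       nonextendable F u /\ forall w : O, bstab w != tw u :> {set _}) ->
  thin (bsum O (tbiset u)).
Proof.
case=> genO nextO orbO Fu cenP.
have cenJ v (C : tbiset u) : centric F (dom v) -> bstab C = tw v ->
    [/\ exists g, tw v = tw u :^ g :> {set _}, nonextendable F u
      & forall w : O, bstab w != tw u :> {set _}].
  move=> cenv stC; have [g eqC] := bstab_tbiset C.
  have eq_v : tw v = tw u :^ g :> {set _} by rewrite -eqC.
  have cenu : centric F (dom u) by rewrite -(centricJ eq_v).
  by have [nextu wu] := cenP cenu; split=> //; exists g.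
have excl v (w : O) (C : tbiset u) : centric F (dom v) ->
    bstab w = tw v -> bstab C = tw v -> False.
  move=> cenv stw stC; have [[g eq_v] _ wu] := cenJ v C cenv stC.
  by case/eqP: (wu (bact O w g^-1)); rewrite bstabJ stw eq_v -conjsgM mulgV conjsg1.
split; first exact: gen_bsum genO (gen_tbiset Fu).
  move=> [] w v Fv cenv; rewrite ?bstab_inl ?bstab_inr => stw; first exact: nextO stw.
  by have [[g eq_v] nextu _] := cenJ v w cenv stw; apply: nonextJ eq_v nextu.
move=> [] w [] w' v Fv cenv; rewrite ?bstab_inl ?bstab_inr => stw stw'.
- by apply: borbit_inl; apply: orbO stw stw'.
- by case: (excl v w w').
- by case: (excl v w' w).
- by apply: borbit_inr; apply: borbit_tbiset stw stw'.
Qed.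

Lemma nice_bsum O u : nice O -> Fmono F u -> ~~ centric F (dom u) ->
  nice (bsum O (tbiset u)).
Proof.
case=> thinO exO Fu ncen; split.
  by apply: thin_bsum => // cen; rewrite cen in ncen.
move=> v Fv cenv nextv; have [w stw] := exO v Fv cenv nextv.
by exists (inl w); rewrite bstab_inl.
Qed.

(** Starting from the empty biset, which is vacuously thin, one adds [P, phi] for a missing maximal
    (P, phi) until none is missing. *)
Lemma nice_ex : exists O, nice O.
Proof.
pose miss O := [set u | [&& Fmono F u, centric F (dom u), nonextendable F u
  & [forall w : O, bstab w != tw u :> {set _}]]].
suffices H O : thin O -> exists O, nice O.
  by apply: (H (bempty gT)); split=> [[]|[]|[]].
have [n] := ubnP #|miss O|; elim: n => // n IHn in O *; rewrite ltnS => le_n thinO.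
case: (set_0Vmem (miss O)) => [miss0|[u]].
  exists O; split=> // u Fu cenu nextu; have: u \notin miss O by rewrite miss0 inE.
  rewrite inE Fu cenu nextu /= negb_forall => /existsP[w].
  by rewrite negbK => /eqP; exists w.
rewrite inE => /and4P[Fu cenu nextu /forallP exu].
apply: (IHn (bsum O (tbiset u))); last exact: thin_bsum.
apply: leq_trans le_n; apply/proper_card/properP; split.
  apply/subsetP=> v; rewrite !inE => /and4P[-> -> -> /forallP missv] /=.
  by apply/forallP=> w; have := missv (inl w); rewrite bstab_inl.
exists u; rewrite !inE Fu cenu nextu /=; first exact/forallP.
by apply/forallP=> /(_ (inr (tbase u))); rewrite bstab_inr bstab_tbase eqxx.
Qed.

Lemma bact1r O (w : O) z : bact O w (1, z) = ract w z.
Proof. by rewrite /= /bact_fun /= invg1 lact1. Qed.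

Lemma ract_inj O (w : O) : injective (ract w).
Proof.
move=> a b eq_ab; apply/eqP; rewrite eq_mulgV1; apply/eqP.
by apply: (@ract_free _ _ w); rewrite ractM eq_ab -ractM mulgV ract1.
Qed.

Lemma center_sub_centric P Q : P \subset Q -> centric F P -> 'Z(Q) \subset 'Z(P).
Proof.
move=> sPQ /centricP cP; apply/subsetP=> z /setIP[_ Cz].
have Cz' : z \in 'C(P) by apply: (subsetP (centS sPQ)).
by rewrite inE Cz' (subsetP (cP _ (fconj_refl _ _))).
Qed.

Lemma conj_center_tw u z : z \in 'Z(dom u) -> tw u :^ (1, z) = tw u.
Proof.
case/setIP=> _ Cz; apply: normP; apply: mem_norm_tw => a Da.
rewrite memJ_pair mem_tw /= conjg1.
by rewrite (conjgE a) -(centP Cz) // mulKg Da eqxx.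
Qed.

(* The right action of Z(P) is regular on the fixed points. *)
Lemma card_fix_nice O u : nice O -> Fmono F u -> centric F (dom u) ->
  #|'Fix_(bact O)(tw u)| = #|'Z(dom u)|.
Proof.
case=> [[genO nextO orbO] exO] Fu cenu.
(* All fixed points are compared with one point [w0] whose stabilizer is a maximal extension of (P,
   phi). *)
have [v [Fv nextv suv]] := max_ext_ex Fu.
have [sDuv _] := tw_subset suv.
have cenv := centricS sDuv cenu.
have [w0 stw0] := exO v Fv cenv nextv.
rewrite -(card_imset (mem 'Z(dom u)) (@ract_inj O w0)); apply: eq_card => w.
rewrite mem_fix; apply/idP/imsetP=> [suw|[z Zz ->]]; last first.
  rewrite -bact1r bstabJ stw0 -(conj_center_tw Zz) conjSg //.
have [v' Fv' stw] := genO w; have suv' : tw u \subset tw v' by rewrite -stw.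
have [sDuv' _] := tw_subset suv'.
have cenv' := centricS sDuv' cenu.
have nextv' := nextO w v' Fv' cenv' stw.
(* Maximal extensions being Z(P)-conjugate, a translate of [w0] has the same stabilizer as [w],
   hence lies in the same orbit. *)
have [z Zz eqv'] := max_ext_conj pS satF Fu Fv Fv' cenu nextv nextv' suv suv'.
have stw0z : bstab (ract w0 z) = tw v' by rewrite -bact1r bstabJ stw0 -eqv'.
have /borbitP[g defw] := orbO _ _ v' Fv' cenv' stw0z stw.
have Ng : g \in 'N(tw v').
  by apply/normP; rewrite -{1}stw0z -bstabJ defw.
(* The element g relating the two points lies in their stabilizer up to some y in the center, so w
   is [w0] moved by z * y^-1. *)
have [y Zy twgy] := norm_tw_max satF Fv' cenv' nextv' Ng.
exists (z * y^-1).
  by rewrite groupM ?groupV // (subsetP (center_sub_centric sDuv' cenu)).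
have : bact O (ract w0 z) (g * (1, y)) = ract w0 z.
  by apply/eqP; rewrite -mem_bstab stw0z.
by rewrite actM defw bact1r ractM => <-; rewrite -ractM mulgV ract1.
Qed.

Lemma card_center_fconj P Q : fconj F P Q -> #|'Z(P)| = #|'Z(Q)|.
Proof.
suffices le R T : fconj F R T -> #|'Z(R)| <= #|'Z(T)|.
  by move=> PQ; apply/eqP; rewrite eqn_leq !le // fconj_sym.
case/fconjP=> f fR defT; rewrite -(card_in_imset (f := f) (D := 'Z(R))); last first.
  by move=> x y /setIP[Rx _] /setIP[Ry _]; apply: (fmor_inj fR).
apply/subset_leq_card/subsetP=> _ /imsetP[x /setIP[Rx Cx] ->].
rewrite inE -defT imset_f //=; apply/centP=> _ /imsetP[y Ry ->].
by rewrite /commute -!(fmorM fR) // (centP Cx).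
Qed.

End CentricPart.

(** * Congruences between numbers of fixed points *)

Section Congruence.
Variables (p : nat) (gT : finGroupType) (F : fusion_system gT).
Hypothesis pS : p.-group [set: gT].
Hypothesis satF : saturated F p.
Implicit Types (O : biset gT) (A B P Q R : {group gT}) (u v : mono gT).
Implicit Types (H N : {group gT * gT}).

(** For an F-generated biset and n = 0 this is full stability, since a graph outside F fixes no
    point. Larger n are the stages of the construction. *)
Definition stable_above n O := forall u v, Fmono F u -> Fmono F v ->
  fconj F (dom u) (dom v) -> n < #|dom u| ->
  #|'Fix_(bact O)(tw u)| = #|'Fix_(bact O)(tw v)|.

Definition fpair (d c : gT -> gT) (g : gT * gT) := (d g.1, c g.2).

(** A fixed point shows that H is the graph of some phi in F. Then H' is the graph of d phi c^-1,
    whose source is F-conjugate to that of phi and of order above n. *)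
Lemma card_fix_fpair_neq0 n O A B c d H H' :
    Fgenerated F O -> stable_above n O -> fmor F A c -> fmor F B d ->
    H \subset setX B A -> fpair d c @: H = H' -> n < #|H| ->
    'Fix_(bact O)(H) != set0 ->
  #|'Fix_(bact O)(H')| = #|'Fix_(bact O)(H)|.
Proof.
move=> genO stO cA dB sHBA defH' ltnH /set0Pn[w]; rewrite mem_fix => fixH.
have [v0 Fv0 stw] := genO w; rewrite stw in fixH.
have [v [Fv twv _ _]] := sub_tw Fv0 fixH.
have domP x : x \in dom v -> x \in A /\ mfun v x \in B.
  move=> Dx; have: (mfun v x, x) \in setX B A.
    by rewrite (subsetP sHBA) // -twv mem_tw /= Dx eqxx.
  by rewrite inE => /andP[].
have sDA : dom v \subset A by apply/subsetP=> x /domP[].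
have cD := fmor_sub cA sDA.
have [k [kR imk cK kK]] := fmor_inv cD (esym (fimE cD)).
have fR : fmor F (fim (dom v) c) (d \o (mfun v \o k)).
  apply: (@fmor_comp _ _ _ B) dB.
    by apply: (@fmor_comp _ _ _ (dom v)) Fv; rewrite ?imk.
  apply/subsetP=> _ /imsetP[y Ry ->] /=.
  have Dky : k y \in dom v by rewrite -imk imset_f.
  by have [_] := domP _ Dky.
have [u [Fu domu eqMu]] := Fmono_ex fR.
have twu : tw u = H' :> {set _}.
  apply/setP=> g; rewrite mem_tw domu -defH' -twv (fimE cD).
  apply/andP/imsetP=> [[/imsetP[x Dx def_x] /eqP def_g1]|[h]].
    exists (mfun v x, x); first by rewrite mem_tw /= Dx eqxx.
    rewrite (surjective_pairing g) /fpair /= -def_x def_g1 eqMu.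
      by rewrite /= def_x cK.
    by rewrite def_x (fimE cD) imset_f.
  move=> tvh ->; have := tvh : h \in tw v; rewrite mem_tw => /andP[Dh /eqP def_h].
  rewrite /fpair /= imset_f // eqMu; last by rewrite (fimE cD) imset_f.
  by rewrite /= cK // -def_h.
rewrite -twu -twv; apply/esym/stO => //.
  by rewrite domu fconj_fim.
by rewrite -card_tw /= twv.
Qed.

(** If H fixes no point but H' does, the inverse pair transports H' to H and the previous case
    applies. *)
Lemma card_fix_fpair n O A B c d H H' :
    Fgenerated F O -> stable_above n O -> fmor F A c -> fmor F B d ->
    H \subset setX B A -> fpair d c @: H = H' -> n < #|H| ->
  #|'Fix_(bact O)(H')| = #|'Fix_(bact O)(H)|.
Proof.
move=> genO stO cA dB sHBA defH' ltnH.
have HP g : g \in H -> g.1 \in B /\ g.2 \in A.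
  by move/(subsetP sHBA); rewrite inE => /andP[].
case: (eqVneq 'Fix_(bact O)(H) set0) => [fix0|]; last first.
  exact: card_fix_fpair_neq0 sHBA defH' ltnH.
case: (eqVneq 'Fix_(bact O)(H') set0) => [->|]; first by rewrite fix0.
have [c' [c'R imc' cK c'K]] := fmor_inv cA (esym (fimE cA)).
have [d' [d'R imd' dK d'K]] := fmor_inv dB (esym (fimE dB)).
move=> nz; apply/esym; apply: card_fix_fpair_neq0 genO stO c'R d'R _ _ _ nz.
- apply/subsetP=> g; rewrite -defH' => /imsetP[h /HP[Bh Ah] ->].
  by rewrite inE /= (fimE cA) (fimE dB) !imset_f.
- rewrite -defH' -imset_comp -[RHS]imset_id; apply: eq_in_imset => h /HP[Bh Ah].
  by rewrite /= /fpair /= cK // dK // -surjective_pairing.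
rewrite -defH' card_in_imset // => g h /HP[Bg Ag] /HP[Bh Ah] [].
move=> /(fmor_inj dB Bg Bh) eq1 /(fmor_inj cA Ag Ah) eq2.
by rewrite (surjective_pairing g) eq1 eq2 -surjective_pairing.
Qed.

(** For P fully normalized, (P, id) is the reference with which all graphs on F-conjugate sources
    are compared. *)
Definition mid (P : {group gT}) := twdiag P id.

(** The last hypothesis places D inside N_f, so the extension given by axiom (II) restricts to D. *)
Lemma fmor_extension P (f : gT -> gT) Q (D : {group gT}) :
    fmor F P f -> f @: P = Q -> fully_centralized F Q ->
    D \subset 'N(P) ->
    {in D, forall a,
       exists2 h, h \in 'N(Q) & {in P, forall x, f (cl a x) = cl h (f x)}} ->
  exists2 c, fmor F D c & {in P :&: D, c =1 f}.
Proof.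
move=> fP imf fcQ nPD ext; have [u [Fu domu eqMu]] := Fmono_ex fP.
have imgu : img u = Q.
  apply/val_inj; rewrite /= domu -imf; exact: eq_in_imset.
have [|v [Fv suv domv]] := extension satF Fu; first by rewrite imgu.
have [_ eqMv] := tw_subset suv.
exists (mfun v).
  apply: fmor_sub Fv _; rewrite domv; apply/subsetP=> a Da.
  apply/setIdP; split; first by rewrite domu (subsetP nPD).
  have [h Nh eq_h] := ext a Da; apply/exists_inP; exists h; rewrite ?imgu //.
  apply/forall_inP=> x; rewrite domu => Px.
  have Pax : cl a x \in P by rewrite clJ memJ_norm ?groupV ?(subsetP nPD).
  by rewrite !eqMu // eq_h.
by move=> x /setIP[Px _]; rewrite -eqMv ?domu // eqMu.
Qed.

(** A and B are the projections of the normalizer of (P, phi). An isomorphism f: P -> Q chosen by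
    Sylow extends to A, and f phi^-1 extends to B; together they send (P, phi) to (Q, id). *)
Lemma norm_transport u Q : Fmono F u -> fconj F (dom u) Q -> fully_normalized F Q ->
  exists A B c d, [/\ fmor F A c, fmor F B d, 'N(tw u) \subset setX B A
    & fpair d c @: tw u = mid Q].
Proof.
move=> Fu uQ fnQ; pose N := ('N(tw u))%G.
pose A := (snd_morphism gT gT @* N)%G; pose B := (fst_morphism gT gT @* N)%G.
have AP a : a \in A -> exists b, (b, a) \in N.
  by case/morphimP=> [[b a'] _ Ng /= ->]; exists b.
have BP b : b \in B -> exists a, (b, a) \in N.
  by case/morphimP=> [[b' a] _ Ng /= ->]; exists a.
have NI g : g \in N -> g.1 \in B /\ g.2 \in A.
  move=> Ng; split; first exact: (mem_morphim (fst_morphism gT gT) (in_setT g) Ng).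
  exact: (mem_morphim (snd_morphism gT gT) (in_setT g) Ng).
have nuA : A \subset 'N(dom u).
  apply/subsetP=> a /AP[b /(norm_tw Fu)[/= Ea _ _]].
  by case/setIdP: Ea.
pose K := (conj_aut (dom u) @* A)%G.
have pK : p.-group K by rewrite morphim_pgroup // (pgroupS (subsetT _)).
have sKA : K \subset AutF F (dom u).
  apply/subsetP=> _ /morphimP[a Na _ ->]; apply/setIdP; split.
    exact: Aut_aut.
  have aE x : x \in dom u -> conj_aut (dom u) a x = cl a^-1 x.
    by move=> Dx; rewrite norm_conj_autE // clJ invgK.
  apply: fmor_hom; first by rewrite (eq_fmor _ (g := cl a^-1)) ?fmor_cl.
  apply/subsetP=> _ /imsetP[x Dx ->]; rewrite aE // clJ invgK memJ_norm //.
have [f [fP imf fK]] := sylow_transport satF fnQ uQ pK sKA.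
have fA a : a \in A ->
    exists2 h, h \in 'N(Q) & {in dom u, forall x, f (cl a x) = cl h (f x)}.
  move=> Aa; have Na' : a^-1 \in 'N(dom u) by rewrite groupV (subsetP nuA).
  have [|h Nh eq_h] := fK (conj_aut (dom u) a^-1).
    by rewrite mem_morphim // groupV.
  by exists h => // x Dx; rewrite -eq_h // norm_conj_autE // clJ.
have fcQ := (satF.1 _ fnQ).1.
have [c cA eqc] := fmor_extension fP imf fcQ nuA fA.
have [k [kR imk uK kK]] := fmor_inv Fu (erefl : mfun u @: dom u = img u).
have dR : fmor F (img u) (f \o k) by apply: fmor_comp fP => //; rewrite imk.
have imd : (f \o k) @: img u = Q by rewrite imset_comp imk imf.
have nuB : B \subset 'N(img u).
  by apply/subsetP=> b /BP[a /(norm_tw Fu)[]].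
(* For (b, a) in the normalizer, phi matches conjugation by a on P with conjugation by b on phi(P),
   so the condition on A passes to B. *)
have fB : {in B, forall b, exists2 h, h \in 'N(Q) &
    {in img u, forall x, (f \o k) (cl b x) = cl h ((f \o k) x)}}.
  move=> b /BP[a Nba]; have [/= _ _ eqba] := norm_tw Fu Nba.
  have [_ /= Aa] := NI _ Nba; have [h Nh eq_h] := fA a Aa.
  have Nua : a \in 'N(dom u) by apply: (subsetP nuA).
  exists h => // _ /imsetP[x Dx ->] /=; rewrite -eqba // !uK //; last first.
    by rewrite clJ memJ_norm ?groupV.
  exact: eq_h.
have [d dB eqd] := fmor_extension dR imd fcQ nuB fB.
exists A, B, c, d; split=> //.
  by apply/subsetP=> g /NI[Bg Ag]; rewrite inE Bg.
have twP x : x \in dom u -> [/\ x \in A, mfun u x \in B & mfun u x \in img u].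
  move=> Dx; have Nx : (mfun u x, x) \in N.
    by rewrite (subsetP (normG _)) // mem_tw /= Dx eqxx.
  by have [] := NI _ Nx; split=> //; apply: imset_f.
apply/setP=> g; rewrite mem_twdiag -imf; apply/imsetP/andP=> [[h]|].
  move=> tuh ->; have := tuh : h \in tw u; rewrite mem_tw => /andP[Dh /eqP def_h].
  have [Ah Bh Ih] := twP _ Dh.
  rewrite /= eqc ?inE ?Dh // imset_f // def_h eqd ?inE ?Bh ?andbT //=.
  by rewrite uK.
case=> /imsetP[x Dx def_x] /eqP def_g; exists (mfun u x, x).
  by rewrite mem_twdiag /= Dx eqxx.
have [Ax Bx Ix] := twP _ Dx.
rewrite /fpair /= eqc ?inE ?Dx // eqd ?inE ?Bx ?andbT //= uK // -def_x.
by rewrite (surjective_pairing g) def_g.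
Qed.

Lemma card_fix_modn n O u Q : Fgenerated F O -> stable_above n O -> Fmono F u ->
    #|dom u| = n -> fconj F (dom u) Q -> fully_normalized F Q ->
  #|'Fix_(bact O)(tw u)| = #|'Fix_(bact O)(mid Q)| %[mod #|'N(tw u) : tw u|].
Proof.
move=> genO stO Fu cardu uQ fnQ.
have [A [B [c [d [cA dB sNBA im_u]]]]] := norm_transport Fu uQ fnQ.
pose N := ('N(tw u))%G.
have NP g : g \in N -> g.1 \in B /\ g.2 \in A.
  by move/(subsetP sNBA); rewrite inE => /andP[].
have tM : {in N &, {morph fpair d c : x y / x * y}}.
  move=> x y /NP[Bx Ax] /NP[By Ay]; rewrite /fpair /= (fmorM dB) // (fmorM cA) //.
have tI : {in N &, injective (fpair d c)}.
  move=> g h /NP[Bg Ag] /NP[Bh Ah] [].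
  move=> /(fmor_inj dB Bg Bh) eq1 /(fmor_inj cA Ag Ah) eq2.
  by rewrite (surjective_pairing g) eq1 eq2 -surjective_pairing.
pose t := Morphism tM; have injt : 'injm t by apply/injmP.
have nuN : tw u <| N := normalG (tw u).
have sub : tw u \subset N := normG _.
have im_t : t @* tw u = mid Q by rewrite morphimEsub.
pose X := 'Fix_(bact O)(tw u); pose Y := 'Fix_(bact O)(mid Q).
have actX : [acts N, on X | bact O] by apply: acts_fix_norm.
have actY : [acts t @* N, on Y | bact O].
  by apply: acts_fix_norm; rewrite -im_t; apply: (normal_norm (morphim_normal _ nuN)).
have FX := Frobenius_Cauchy actX; have FY := Frobenius_Cauchy actY.
(* Outside (P, phi) the terms of the two Cauchy-Frobenius sums agree: g and (P, phi) generate a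
   group of order above n, where stability is known. *)
have eq_out g : g \in N -> g \notin tw u ->
    #|'Fix_(Y | bact O)[t g]| = #|'Fix_(X | bact O)[g]|.
  move=> Ng notug; pose H := (tw u <*> <[g]>)%G.
  have sgN : <[g]> \subset N by rewrite cycle_subG.
  have sHN : H \subset N by rewrite join_subG sub sgN.
  have defX : 'Fix_(X | bact O)[g] = 'Fix_(bact O)(H).
    by rewrite (afixYin (bact O) (subsetT _) (subsetT _)) -/X /X afix_cycle.
  have defY : 'Fix_(Y | bact O)[t g] = 'Fix_(bact O)(t @* H).
    rewrite morphimY // morphim_cycle // im_t.
    by rewrite (afixYin (bact O) (subsetT _) (subsetT _)) afix_cycle.
  rewrite defX defY; apply: (card_fix_fpair genO stO cA dB (subset_trans sHN sNBA)).
    by rewrite /= morphimEsub.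
  rewrite -cardu -card_tw proper_card // properE joing_subl /=.
  apply: contra notug => /subsetP; apply.
  by rewrite (subsetP (joing_subr _ _)) ?cycle_id.
have eq_inX g : g \in tw u -> #|'Fix_(X | bact O)[g]| = #|X|.
  by move=> ug; congr #|pred_of_set _|; apply/setIidPl; apply: afixS; rewrite sub1set.
have eq_inY g : g \in tw u -> #|'Fix_(Y | bact O)[t g]| = #|Y|.
  move=> ug; congr #|pred_of_set _|; apply/setIidPl; apply: afixS.
  by rewrite sub1set -im_t mem_morphim ?(subsetP sub).
rewrite /= (morphimEdom t) big_imset //= in FY.
have split_sum (E : gT * gT -> nat) k : (forall g, g \in tw u -> E g = k) ->
    (\sum_(g in N) E g = #|tw u| * k + \sum_(g in N | g \notin tw u) E g)%N.
  move=> Ek; rewrite (bigID (mem (tw u))) /=; congr (_ + _)%N.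
  rewrite (eq_bigr (fun=> k)) => [|g /andP[_ /Ek]//].
  rewrite sum_nat_const; congr (_ * k)%N; apply: eq_card => g.
  by apply: andb_idl => /(subsetP sub).
rewrite (split_sum _ _ eq_inX) in FX; rewrite (split_sum _ _ eq_inY) in FY.
rewrite (eq_bigr (fun g => #|'Fix_(X | bact O)[g]|)) in FY; last first.
  by move=> g /andP[Ng ug]; apply: eq_out.
have cardN : (#|N| = #|tw u| * #|N : tw u|)%N by rewrite Lagrange.
(* Both sums are multiples of |N|; removing the common terms leaves |P| times each count, and |P|
   cancels from the congruence. *)
have: #|tw u| * #|X| = #|tw u| * #|Y| %[mod #|tw u| * #|N : tw u|].
  rewrite -cardN; apply/eqP.
  rewrite -(eqn_modDr (\sum_(g in N | g \notin tw u) #|'Fix_(X | bact O)[g]|)).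
  by rewrite FX FY (card_in_imset tI) !modnMl.
rewrite -!muln_modr => /eqP; rewrite eqn_pmul2l ?cardG_gt0 // => /eqP.
done.
Qed.

End Congruence.

(** * Stabilization by noncentric orbits *)

Section Construction.
Variables (p : nat) (gT : finGroupType) (F : fusion_system gT).
Hypothesis pS : p.-group [set: gT].
Hypothesis satF : saturated F p.
Implicit Types (O L : biset gT) (P Q R : {group gT}) (u v : mono gT).

Notation mark O K := #|'Fix_(bact O)(K)|.
Notation weyl u := #|'N(tw u) : tw u|.

(** A fixed point puts [tw u] inside a conjugate of [tw v], and the orders force equality. *)
Lemma mark_tbiset u v : #|dom v| <= #|dom u| -> mark (tbiset v) (tw u) != 0 ->
  exists g, tw u = tw v :^ g :> {set _}.
Proof.
move=> le_vu; rewrite cards_eq0 => /set0Pn[C]; rewrite mem_fix.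
have [g ->] := bstab_tbiset C => sub; exists g; apply/eqP.
by rewrite eqEcard sub cardJg !card_tw.
Qed.

Definition noncentric_at n u := [&& Fmono F u, ~~ centric F (dom u) & #|dom u| == n].

(** Among sources of order at least n, adding [Q, psi] with |Q| = n changes only the marks at
    conjugates of (Q, psi), each by the Weyl index. Deficits divisible by these indices are thus
    filled one orbit at a time, by induction on the total deficit. *)
Lemma fill_marks n O (t : mono gT -> nat) : nice F O ->
    (forall u v g, tw v = tw u :^ g :> {set _} -> t v = t u) ->
    (forall u, noncentric_at n u ->
       mark O (tw u) <= t u /\ mark O (tw u) = t u %[mod weyl u]) ->
  exists O', [/\ nice F O',
    forall u, n < #|dom u| -> mark O' (tw u) = mark O (tw u)
    & forall u, noncentric_at n u -> mark O' (tw u) = t u].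
Proof.
move=> niceO tJ; have [k] := ubnP (\sum_(u | noncentric_at n u) (t u - mark O (tw u))).
elim: k => // k IHk in O niceO *; rewrite ltnS => le_k inv.
case: (pickP (fun v => noncentric_at n v && (mark O (tw v) < t v))) => [v|done_]; last first.
  exists O; split=> // u Xu; have [le_u _] := inv u Xu.
  by apply/eqP; have := done_ u; rewrite Xu eqn_leq le_u ltnNge /= => /negbFE.
case/andP=> Xv lt_v; have /and3P[Fv ncv /eqP cardv] := Xv.
have [_ mod_v] := inv v Xv.
have weylv : mark (tbiset v) (tw v) = weyl v by apply: card_fix_tbiset.
(* The deficit is positive and divisible by the Weyl index, so one more orbit does not overshoot. *)
have room : mark O (tw v) + weyl v <= t v.
  have: weyl v %| t v - mark O (tw v).
    by rewrite -eqn_mod_dvd ?(ltnW lt_v) // eq_sym; apply/eqP.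
  by move/dvdn_leq; rewrite subn_gt0 lt_v leq_subRL ?(ltnW lt_v) // => ->.
have step u : noncentric_at n u ->
     mark (tbiset v) (tw u) = 0 \/
     [/\ mark O (tw u) = mark O (tw v), t u = t v, weyl u = weyl v
      & mark (tbiset v) (tw u) = weyl v].
  case/and3P=> Fu ncu /eqP cardu; case: (eqVneq (mark (tbiset v) (tw u)) 0); first by left.
  case/mark_tbiset; rewrite ?cardu ?cardv // => g eq_u; right.
  by rewrite (tJ _ _ _ eq_u) !eq_u !card_fixJ normJ indexJg weylv.
have [||O' [niceO' above at_n]] := IHk (bsum O (tbiset v)) (nice_bsum niceO Fv ncv).
- apply: leq_trans le_k; rewrite (bigD1 v Xv) [X in _ < X](bigD1 v Xv).
  rewrite -addSn leq_add //.
    rewrite card_fix_bsum weylv ltn_sub2l // -addn1 leq_add2l.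
    by rewrite indexg_gt0.
  by apply: leq_sum => u _; rewrite card_fix_bsum leq_sub2l ?leq_addr.
- move=> u Xu; have [le_u mod_u] := inv u Xu; rewrite card_fix_bsum.
  case: (step u Xu) => [->|[eqm eqt eqw ->]]; first by rewrite addn0.
  rewrite eqm eqt; split=> //.
  by rewrite eqw modnDr -eqw -eqm mod_u eqt.
exists O'; split=> // u lt_u; rewrite above // card_fix_bsum.
case: (eqVneq (mark (tbiset v) (tw u)) 0) => [->|]; first by rewrite addn0.
case/mark_tbiset; rewrite ?cardv 1?ltnW // => g eq_u.
by move: lt_u; rewrite (twJ_dom eq_u) cardJg cardv ltnn.
Qed.

Lemma stable_step n O : nice F O -> stable_above F n.+1 O ->
  exists O', nice F O' /\ stable_above F n O'.
Proof.
move=> niceO stO; have [[genO _ _] _] := niceO.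
(* One fully normalized representative per F-conjugacy class; the default is never taken, as such a
   conjugate always exists. *)
pose Q P := odflt P [pick Q : {group gT} | fconj F P Q && fully_normalized F Q].
have QP P : fconj F P (Q P) /\ fully_normalized F (Q P).
  rewrite /Q; case: pickP => [R /andP[]//|none].
  by have [R PR fnR] := fully_normalized_ex F P; have := none R; rewrite PR fnR.
have QE P R : fconj F P R -> Q P = Q R.
  move=> PR; rewrite /Q; have eqPR : fconj F P =1 fconj F R.
    move=> T; apply/idP/idP; apply: fconj_trans; last by [].
    by rewrite fconj_sym.
  have -> : [pick T : {group gT} | fconj F P T && fully_normalized F T]
          = [pick T : {group gT} | fconj F R T && fully_normalized F T].
    by apply: eq_pick => T; rewrite eqPR.
  case: pickP => //= none.
  by have [T RT fnT] := fully_normalized_ex F R; have := none T; rewrite RT fnT.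
(* The second summand is divisible by every Weyl index, so residues are kept, and it makes the
   target at least as large as every current mark. *)
pose t u := (mark O (mid (Q (dom u))) + #|O| * #|[set: gT * gT]|)%N.
have [u v g eqv|u|O' [niceO' above at_n]] := @fill_marks n.+1 O t niceO.
- rewrite /t (twJ_dom eqv); congr (mark O (mid _) + _)%N.
  by apply/esym/QE/fconjJ.
- case/and3P=> Fu _ /eqP cardu; have [uQ fnQ] := QP (dom u); split.
    rewrite /t (leq_trans _ (leq_addl _ _)) // (leq_trans (max_card _)) //.
    by rewrite leq_pmulr // cardG_gt0.
  rewrite (card_fix_modn pS satF genO stO Fu cardu uQ fnQ) /t.
  have /dvdnP[k ->] : weyl u %| #|[set: gT * gT]|.
    by apply: dvdn_trans (dvdn_indexg _ _) _; apply: cardSg (subsetT _).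
  by rewrite mulnA addnC modnMDl.
exists O'; split=> // u v Fu Fv uv lt_u; have eqc := card_fconj uv.
move: lt_u; rewrite leq_eqVlt => /predU1P[cardu | lt_u]; last first.
  by rewrite !above -?eqc //; apply: stO.
(* At centric sources the marks are the orders of the centers, already invariant under
   F-conjugacy. *)
case: (boolP (centric F (dom u))) => cenu.
  have cenv := centric_fconj uv cenu.
  by rewrite !(card_fix_nice pS satF niceO') // (card_center_fconj uv).
have ncenv : ~~ centric F (dom v).
  by apply: contra cenu; apply: centric_fconj; rewrite fconj_sym.
have Xu : noncentric_at n.+1 u by rewrite /noncentric_at Fu cenu -cardu eqxx.
have Xv : noncentric_at n.+1 v by rewrite /noncentric_at Fv ncenv -eqc -cardu eqxx.
by rewrite !at_n // /t (QE _ _ uv).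
Qed.

Lemma nice_stable_ex : exists O, nice F O /\ stable_above F 0 O.
Proof.
suffices H k : k <= #|[set: gT]| -> exists O, nice F O /\ stable_above F (#|[set: gT]| - k) O.
  by have := H _ (leqnn _); rewrite subnn.
elim: k => [_|k IHk lt_k].
  (* No subgroup has order above |S|, so the descent starts vacuously. *)
  have [O niceO] := nice_ex F; exists O; split=> // u v _ _ _.
  by rewrite subn0 ltnNge subset_leq_card ?subsetT.
have [O [niceO stO]] := IHk (ltnW lt_k).
by apply: (stable_step niceO); rewrite subnSK.
Qed.

Lemma fix_fmor O P f : Fgenerated F O -> mark O (twdiag P f) != 0 -> fmor F P f.
Proof.
move=> genO; rewrite cards_eq0 => /set0Pn[w]; rewrite mem_fix.
have [u Fu ->] := genO w => /subsetP sub.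
have uP x : x \in P -> x \in dom u /\ f x = mfun u x.
  move=> Px; have : (f x, x) \in tw u by rewrite sub // mem_twdiag /= Px eqxx.
  by rewrite mem_tw /= => /andP[-> /eqP].
rewrite (eq_fmor _ (g := mfun u)) => [|x /uP[] //].
by apply: (fmor_sub Fu); apply/subsetP=> x /uP[].
Qed.

(** The composite with [e1] and [e2] is in F exactly when [mfun u] is; when neither is, both
    fixed-point sets are empty. *)
Lemma stable_above0_stable O : Fgenerated F O -> stable_above F 0 O -> stable F O.
Proof.
move=> genO stO u e1 e2; rewrite !misofE => Fe1 im1 Fe2 dom2.
have im1' : mfun e1 @: dom e1 = dom u by rewrite -im1.
pose f := mfun e2 \o mfun u \o mfun e1.
have [k [kD imk e1K kK]] := fmor_inv Fe1 im1'.
have [l [lD iml e2K lK]] := fmor_inv Fe2 (erefl : _ = gval (img e2)).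
have eq_u x : x \in dom u -> mfun u x = l (f (k x)).
  by move=> Dx; rewrite /f /= kK // e2K // dom2 imset_f.
have eqf : fmor F (dom e1) f = Fmono F u.
  apply/idP/idP=> [fF | Fu].
    rewrite /Fmono (eq_fmor _ eq_u).
    apply: (@fmor_comp _ _ _ (img e2)) lD.
      by apply: (@fmor_comp _ _ _ (dom e1)) fF; rewrite ?imk.
    apply/subsetP=> _ /imsetP[x Dx ->]; rewrite /f /= kK //.
    by rewrite imset_f // dom2 imset_f.
  apply: (@fmor_comp _ _ _ (dom u)) => //; rewrite ?im1' //.
  by apply: (@fmor_comp _ _ _ (img u)) => //; rewrite -dom2.
case: (boolP (Fmono F u)) => Fu; last first.
  have [-> ->] : mark O (tw u) = 0 /\ mark O (twdiag (dom e1) f) = 0; last by [].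
  split; apply/eqP; apply: contraNT Fu; last by move/(fix_fmor genO); rewrite eqf.
  exact: fix_fmor.
have fF : fmor F (dom e1) f by rewrite eqf.
have [v [Fv domv eqv]] := Fmono_ex fF.
have -> : twdiag (dom e1) f = tw v.
  apply/setP=> g; rewrite mem_twdiag mem_tw domv.
  by case: (boolP (g.2 \in _)) => // /eqv->.
apply: stO => //; rewrite domv fconj_sym; apply/fconjP; by exists (mfun e1).
Qed.

Lemma stable_stable_above0 O : stable F O -> stable_above F 0 O.
Proof.
move=> stO u v Fu Fv; rewrite fconj_sym => /fconjP[k kD imk] _.
have [l [lD iml kK lK]] := fmor_inv kD imk.
have [i [iD imi uK iK]] := fmor_inv Fu (erefl : mfun u @: dom u = img u).
have [e1 [Fe1 dom1 eq1]] := Fmono_ex kD.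
(* With k as the first isomorphism, v k^-1 u^-1 is the choice of the second one that makes the
   composite equal to v. *)
have e2D : fmor F (img u) (mfun v \o (l \o i)).
  apply: (@fmor_comp _ _ _ (dom v)) => //; last by rewrite imset_comp imi iml.
  by apply: (@fmor_comp _ _ _ (dom u)) => //; rewrite imi.
have [e2 [Fe2 dom2 eq2]] := Fmono_ex e2D.
have im1 : img e1 = dom u.
  by apply/val_inj; rewrite /= dom1 -imk; apply: eq_in_imset.
rewrite [LHS](stO u e1 e2) ?misofE //; congr #|pred_of_set ('Fix_(_)(_))|.
apply/setP=> g; rewrite mem_twdiag mem_tw dom1.
case: (boolP (g.2 \in dom v)) => //= Dg; have Dk : k g.2 \in dom u by rewrite -imk imset_f.
by rewrite eq1 // eq2 ?imset_f //= uK // kK.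
Qed.

End Construction.

(** * Counting points modulo p|S| *)

Section Counting.
Variables (p : nat) (gT : finGroupType) (F : fusion_system gT).
Hypothesis pS : p.-group [set: gT].
Implicit Types (O L : biset gT) (P Q R : {group gT}) (u v : mono gT).

Notation mark O K := #|'Fix_(bact O)(K)|.
Notation gS := [set: gT]%G.

Definition full u := Fmono F u && (dom u == gS).

Lemma tw_mid P : exists v, [/\ Fmono F v, dom v = P & tw v = mid P :> {set _}].
Proof.
have [v [Fv domv eqv]] := Fmono_ex (fmor_id F P); exists v; split=> //.
apply/setP=> g; rewrite mem_tw mem_twdiag domv.
by case: (boolP (g.2 \in P)) => // /eqv->.
Qed.

(** The orbit has |S| |S : P| points, and |S : P| is a nontrivial power of p. *)
Lemma dvdn_borbit O (w : O) u : bstab w = tw u -> dom u != gS ->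
  p * #|[set: gT]| %| #|borbit w|.
Proof.
move=> stw neqS; rewrite /borbit card_orbit.
have -> : 'C_([set: gT * gT])[w | bact O] = tw u by rewrite setTI.
have cardG : (#|[set: gT * gT]| = #|[set: gT]| * #|[set: gT]|)%N.
  by rewrite !cardsT card_prod.
have := Lagrange (subsetT (dom u)); rewrite -card_tw => LS.
have -> : (#|[set: gT * gT] : tw u| = #|[set: gT]| * #|[set: gT] : dom u|)%N.
  apply/eqP; rewrite -(eqn_pmul2l (cardG_gt0 (tw u))) Lagrange ?subsetT // cardG.
  by rewrite mulnCA LS.
rewrite mulnC dvdn_pmul2l ?cardG_gt0 //.
have: p.-nat #|[set: gT] : dom u| by apply: pnat_dvd (dvdn_indexg _ _) pS.
case/p_natP=> [[|k]] idx; last by rewrite idx expnS dvdn_mulr.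
case/eqP: neqS; apply/val_inj/eqP; rewrite eqEsubset subsetT /=.
by rewrite -indexg_eq1 idx.
Qed.

Lemma card_modn O : Fgenerated F O -> stable_above F 0 O ->
  #|O| = #|[set u | full u]| * mark O (mid gS) %[mod p * #|[set: gT]|].
Proof.
move=> genO stO.
pose D := [set w : O | #|bstab w| == #|[set: gT]|].
have cardD : #|D| = (#|[set u | full u]| * mark O (mid gS))%N.
  transitivity (\sum_(u | full u) mark O (tw u)).
    rewrite -sum1_card.
    (* Double counting: a point whose stabilizer has order |S| is fixed by exactly one (S, alpha)
       with alpha in F, and by stability all the (S, alpha) have the mark of (S, id). *)
    transitivity (\sum_(w in D) \sum_(u | full u) (tw u \subset bstab w : nat)).
      apply: eq_bigr => w; rewrite inE => /eqP cardw; have [v Fv stw] := genO w.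
      have fullv : full v.
        rewrite /full Fv; apply/eqP/val_inj/eqP; rewrite /= eqEcard subsetT.
        by rewrite -(card_tw v) -stw cardw leqnn.
      rewrite (bigD1 v fullv) stw subxx big1 // => u /andP[/andP[Fu /eqP domu] neq_uv].
      apply/eqP; rewrite eqb0; apply: contra neq_uv => sub; apply/eqP/tw_inj/eqP.
      by rewrite eqEcard sub /= -stw cardw card_tw domu.
    rewrite exchange_big /=; apply: eq_bigr => u /andP[Fu /eqP domu].
    rewrite -sum1_card [RHS]big_mkcond [LHS]big_mkcond /=; apply: eq_bigr => w _.
    rewrite mem_fix inE; case: ifP => [_|/eqP ncard]; first by case: (_ \subset _).
    case: ifP => // sub; case: ncard; have [v _ stw] := genO w.
    apply/eqP; rewrite eqn_leq stw card_tw subset_leq_card ?subsetT //=.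
    by have := subset_leq_card sub; rewrite stw !card_tw domu.
  rewrite -sum_nat_const; apply: eq_big => [u|u /andP[Fu /eqP domu]]; first by rewrite inE.
  have [v [Fv domv <-]] := tw_mid gS.
  by apply: stO => //; rewrite domu domv fconj_refl.
have: p * #|[set: gT]| %| #|~: D|.
  have actD : [acts [set: gT * gT], on ~: D | bact O].
    apply/actsP=> g _ w; rewrite !inE; congr (~~ (_ == _)).
    by rewrite bstabJ cardJg.
  rewrite -(acts_sum_card_orbit actD); apply: dvdn_sum => _ /imsetP[w Dw ->].
  have [u Fu stw] := genO w; apply: (dvdn_borbit stw).
  by apply: contraTneq Dw => domu; rewrite !inE stw card_tw domu negbK.
move=> /dvdnP[k cardC]; rewrite -cardsT -(cardsID D [set: O]) setTI.
rewrite setTD cardC cardD addnC modnMDl //.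
Qed.

Definition ract_act O := TotalAction (@ract1 gT O) (@ractM gT O).

Lemma dvdn_ract O (R : {group gT}) (X : {set O}) :
  (forall w a, a \in R -> w \in X -> ract w a \in X) -> #|R| %| #|X|.
Proof.
move=> XR; have actR : [acts R, on X | ract_act O].
  apply/actsP=> a Ra w; apply/idP/idP; last exact: XR.
  by move=> Xwa; rewrite -(ract1 w) -(mulgV a) ractM; apply: XR; rewrite ?groupV.
rewrite -(acts_sum_card_orbit actR); apply: dvdn_sum => _ /imsetP[w Xw ->].
rewrite card_orbit; suffices -> : 'C_R[w | ract_act O] = 1 by rewrite indexg1.
apply/trivgP/subsetP=> a /setIP[_ /astab1P/ract_free ->]; exact: group1.
Qed.

Lemma dvdn_card_biset O : #|[set: gT]| %| #|O|.
Proof. by rewrite -[#|O|]cardsT; apply: dvdn_ract. Qed.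

(** For z in Z(S) the pair (1, z) normalizes (S, id), so Z(S) acts freely on the right on its fixed
    points. *)
Lemma dvdn_center_mark O : #|'Z([set: gT])| %| mark O (mid gS).
Proof.
apply: dvdn_ract => w a /setIP[_ Ca]; rewrite !mem_fix => sub.
have [v [Fv domv twv]] := tw_mid gS; rewrite -twv in sub *.
by rewrite -bact1r bstabJ -(@conj_center_tw _ v a) ?conjSg // domv inE Ca inE.
Qed.

Lemma characteristicP O : characteristic F p O <->
  [/\ Fgenerated F O, stable_above F 0 O
    & ~~ (p * #|[set: gT]| %| #|[set u | full u]| * mark O (mid gS))].
Proof.
have dvdE : Fgenerated F O -> stable_above F 0 O -> (p %| #|O| %/ #|[set: gT]|)
  = (p * #|[set: gT]| %| #|[set u | full u]| * mark O (mid gS)).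
  move=> genO stO; rewrite dvdn_divRL ?dvdn_card_biset //.
  by rewrite /dvdn (card_modn genO stO).
split=> [[/generatedE genO /stable_stable_above0 stO]|[genO stO]].
  by rewrite dvdE.
rewrite -dvdE // => ndvd; split=> //; first exact/generatedE.
exact: stable_above0_stable.
Qed.

End Counting.

(** * The centric part of the minimal biset *)

Section Main.
Variables (p : nat) (gT : finGroupType) (F : fusion_system gT) (L : biset gT).
Hypothesis pS : p.-group [set: gT].
Hypothesis satF : saturated F p.
Hypothesis minL : minimal_characteristic F p L.
Implicit Types (u v : mono gT).

(* The point counts of O and of L modulo p|S| are N |Z(S)| and N m, with the same
   N and with m a multiple of |Z(S)|; so p|S| cannot divide the first without
   dividing the second. *)
Lemma thin_characteristic : exists2 O, thin F O & characteristic F p O.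
Proof.
have [O [niceO stO]] := nice_stable_ex pS satF.
have [[genO _ _] _] := niceO; exists O; first by case: niceO.
have [/(characteristicP F pS)[genL stL ndvd] _] := minL.
apply/(characteristicP F pS); split=> //; apply: contra ndvd.
have [v [Fv domv twv]] := tw_mid F [set: gT]%G.
rewrite -{1}twv (card_fix_nice pS satF niceO) ?domv ?centricT //.
by move=> /dvdn_trans; apply; rewrite dvdn_mul // dvdn_center_mark.
Qed.

Lemma gen_minimal : Fgenerated F L.
Proof. by have [/(characteristicP F pS)[]] := minL. Qed.

(** By minimality L embeds in a thin characteristic biset; embeddings preserve stabilizers and
    reflect orbits, so thinness is inherited. *)
Lemma thin_minimal : thin F L.
Proof.
have [O [genO nextO orbO] charO] := thin_characteristic.
have [_ /(_ O charO)/existsP[f emb]] := minL.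
have stf := bstab_embedding emb.
split; first exact: gen_minimal.
  by move=> w u Fu cenu stw; apply: (nextO (f w)); rewrite ?stf.
move=> w w' u Fu cenu stw stw'.
have /borbitP[g] : f w' \in borbit (f w) by apply: (orbO _ _ u); rewrite ?stf.
rewrite -(embedding_bact emb) => /(embedding_inj emb) <-.
by apply/borbitP; exists g.
Qed.

Lemma bstab_minimal_ex u : Fmono F u -> nonextendable F u ->
  exists w : L, bstab w = tw u.
Proof.
move=> Fu nextu; have [/(characteristicP F pS)[genL stL ndvd] _] := minL.
(* The count modulo p|S| is a multiple of the mark of (S, id), which therefore cannot vanish. *)
have: 'Fix_(bact L)(mid [set: gT]%G) != set0.
  by rewrite -cards_eq0; apply: contraNneq ndvd => ->; rewrite muln0 dvdn0.
case/set0Pn=> w; rewrite mem_fix => fixw.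
have [v [Fv domv twv]] := tw_mid F (dom u).
have eq_uv : #|'Fix_(bact L)(tw u)| = #|'Fix_(bact L)(tw v)|.
  by apply: stL; rewrite ?domv ?fconj_refl ?cardG_gt0.
have: 'Fix_(bact L)(tw u) != set0.
  rewrite -cards_eq0 eq_uv cards_eq0; apply/set0Pn; exists w.
  rewrite mem_fix (subset_trans _ fixw) // twv; apply/subsetP=> g.
  by rewrite !mem_twdiag inE => /andP[_ ->].
case/set0Pn=> w'; rewrite mem_fix; have [u' Fu' stw'] := genL w'.
by rewrite stw' => /(nonextP Fu nextu _ Fu') eq_u; exists w'; rewrite stw' eq_u.
Qed.

(** The graph of c_b phi c_a is the conjugate of that of phi by (b^-1, a). *)
Lemma iso_equivP u v : reflect (exists g, tw v = tw u :^ g :> {set _}) (iso_equiv u v).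
Proof.
apply: (iffP existsP) => [[a /existsP[b /andP[/eqP domv /eqP mv]]]|[[b a] eqv]].
  exists (b^-1, a); apply/setP=> [[y x]].
  rewrite mem_conjg memJ_pair !mem_tw /= domv mem_conjg.
  case: (boolP (x ^ a^-1 \in dom u)) => //= Dx.
  rewrite mv restrE /=; last by rewrite domv mem_conjg.
  by rewrite !clJ invgK; apply/eqP/eqP=> [->|<-]; rewrite ?conjgK ?conjgKV.
exists a; apply/existsP; exists b^-1; have domv := twJ_dom eqv.
rewrite domv eqxx; apply/eqP; rewrite -[LHS]mfun_restr domv; apply: eq_restr => x.
rewrite mem_conjg => Dx; have: (mfun v x, x) \in tw v.
  by rewrite mem_tw domv /= mem_conjg Dx eqxx.
rewrite eqv mem_conjg memJ_pair mem_tw /= => /andP[_ /eqP eqx].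
by rewrite !clJ -eqx invgK conjgKV.
Qed.

End Main.

Theorem theoremD (p : nat) (gT : finGroupType) (F : fusion_system gT)
    (L : biset gT) (p_pr : prime p) (pS : p.-group [set: gT])
    (satF : saturated F p) (minL : minimal_characteristic F p L) :
  exists Theta : {set mono gT} -> {set L},
    [/\ {in iso_classes F &, injective Theta},
        Theta @: iso_classes F = [set borbit w | w in centric_part F L]
      & forall (C : {set mono gT}) (u : mono gT),
          C \in iso_classes F -> u \in C -> iso_onto (tbiset u) (Theta C)].
Proof.
have [genL nextL orbL] := thin_minimal pS satF minL.
have isoP u : reflect [/\ Fmono F u, centric F (dom u) & nonextendable F u]
                      (u \in nonext_centric_isos F).
  rewrite inE misofE; apply: (iffP and4P) => [[]//|[Fu cenu nextu]]; split=> //.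
  exact: centric_fconj (img_fconj Fu) cenu.
have equivR : equivalence_rel (@iso_equiv gT).
  have sym u v : iso_equiv u v -> iso_equiv v u.
    case/iso_equivP=> g eqv; apply/iso_equivP; exists g^-1.
    by rewrite eqv -conjsgM mulgV conjsg1.
  have trans u v w : iso_equiv u v -> iso_equiv v w -> iso_equiv u w.
    case/iso_equivP=> g eqv /iso_equivP[h eqw]; apply/iso_equivP; exists (g * h).
    by rewrite eqw eqv conjsgM.
  move=> u v w; split=> [|uv]; first by apply/iso_equivP; exists 1; rewrite conjsg1.
  by apply/idP/idP; apply: trans => //; apply: sym.
have classP C : C \in iso_classes F ->
    exists2 u, u \in nonext_centric_isos F &
      C = [set v in nonext_centric_isos F | iso_equiv u v].
  by case/imsetP=> u; exists u.
(* The default [set0] is never reached on a class, since each of its members is the stabilizer of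
   some point. *)
pose Theta (C : {set mono gT}) : {set L} :=
  if [pick w : L | [exists u in C, bstab w == tw u :> {set _}]] is Some w
  then borbit w else set0.
(* Independence of the choice: two candidate points have conjugate stabilizers, so one can be moved
   to share the stabilizer of the other, and thinness puts them in one orbit. *)
have ThetaE C u (w : L) : C \in iso_classes F -> u \in C -> bstab w = tw u ->
    Theta C = borbit w.
  case/classP=> u0 _ -> ; rewrite inE => /andP[/isoP[Fu cenu nextu] u0u] stw.
  rewrite /Theta; case: pickP => [w' /exists_inP[u' ]|none]; last first.
    have := none w; rewrite (_ : [exists u in _, _]) //; apply/exists_inP; exists u.
      by rewrite inE u0u andbT; apply/isoP.
    by apply/eqP.
  rewrite inE => /andP[/isoP[Fu' cenu' _] u0u'] /eqP stw'.
  have /iso_equivP[g eqg] : iso_equiv u' u.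
    have [_ /(_ u0u') <- //] := equivR u0 u' u.
  have stg : bstab (bact L w' g) = tw u by rewrite bstabJ stw'.
  have /borbitP[h <-] := orbL _ _ u Fu cenu stg stw.
  by apply/esym/orbit_eqP/borbitP; exists (g * h); rewrite actM.
have class_ex C u : C \in iso_classes F -> u \in C ->
    [/\ Fmono F u, centric F (dom u) & exists2 w : L, bstab w = tw u & Theta C = borbit w].
  move=> CF Cu; have [u0 _ defC] := classP C CF.
  have /isoP[Fu cenu nextu] : u \in nonext_centric_isos F.
    by move: Cu; rewrite defC inE => /andP[].
  have [w stw] := bstab_minimal_ex pS minL Fu nextu.
  by split=> //; exists w => //; apply: ThetaE stw.
have class_rep C : C \in iso_classes F -> exists2 u, u \in C &
    C = [set v in nonext_centric_isos F | iso_equiv u v].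
  case/classP=> u isou ->; exists u => //; rewrite inE isou.
  by have [-> _] := equivR u u u.
exists Theta; split.
- move=> C1 C2 CF1 CF2.
  have [u1 Cu1 defC1] := class_rep C1 CF1; have [u2 Cu2 defC2] := class_rep C2 CF2.
  have [_ _ [w1 stw1 ->]] := class_ex C1 u1 CF1 Cu1.
  have [_ _ [w2 stw2 ->]] := class_ex C2 u2 CF2 Cu2.
  move=> eqo; have /borbitP[g defw1] : w1 \in borbit w2 by rewrite -eqo; apply: orbit_refl.
  have u21 : iso_equiv u2 u1.
    by apply/iso_equivP; exists g; rewrite -stw1 -stw2 -bstabJ defw1.
  rewrite defC1 defC2; apply/setP=> v; rewrite !inE.
  by have [_ /(_ u21) ->] := equivR u2 u1 v.
- apply/setP=> X; apply/imsetP/imsetP=> [[C CF ->]|[w cenw ->]].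
    have [u Cu _] := class_rep C CF.
    have [Fu cenu [w stw ->]] := class_ex C u CF Cu; exists w => //.
    rewrite inE; apply/existsP=> [[v /andP[ncenv /iso_ontoP[w' /borbitP[g <-]]]]].
    by rewrite bstabJ stw => /esym eqv; rewrite (centricJ F eqv) cenu in ncenv.
  (* Conversely, a point of the centric part has a stabilizer with centric source; thinness makes it
     nonextendable, and its class is sent to the orbit. *)
  have [u Fu stw] := genL w.
  have cenu : centric F (dom u).
    move: cenw; rewrite inE; apply: contraNT => ncen; apply/existsP; exists u.
    by rewrite ncen; apply/iso_ontoP; exists w => //; apply: orbit_refl.
  have isou : u \in nonext_centric_isos F by apply/isoP; split=> //; apply: nextL stw.
  exists [set v in nonext_centric_isos F | iso_equiv u v]; first exact: imset_f.
  apply/esym; apply: (ThetaE _ u) stw; first exact: imset_f.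
  by rewrite inE isou; have [-> _] := equivR u u u.
move=> C u CF Cu; have [Fu cenu [w stw ->]] := class_ex C u CF Cu.
by apply/iso_ontoP; exists w => //; apply: orbit_refl.
Qed.
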